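(* Let $H_0$ and $D$ be monoids and define $$H=H_0\propto D=\big((H_0\setminus H_0^\times)\times D\big)\;\cup\;\big(H_0^\times\times\{1_D\}\big).$$ Then $H$ is a submonoid of $H_0\times D$. If $D=\{1_D\}$ or $H_0$ is a group, then $H=H_0$ (identifying $H_0$ with $H_0\times\{1_D\}$). Suppose that $D\ne\{1_D\}$ and that $H_0$ is not a group. 1. $H^\times=H_0^\times\times\{1_D\}$. 2. $\mathsf q(H)=\mathsf q(H_0)\times\mathsf q(D)$, $H\subset H_0\times D$ is not saturated, and $\widehat H=\widehat{H_0}\times\widehat D$. In particular, $H$ is not completely integrally closed and hence not a Krull monoid. 3. The projection $\theta:H\to H_0$, $(a,d)\mapsto a$, is a transfer homomorphism. 4. Suppose $H_0$ and $D$ are atomic. Let $u\in\mathcal A(H_0)$ and $d\in D$. Then $$\max\{\omega(H_0,u),\omega(D,d)\}\le\omega(H,(u,d))\le\omega(H_0,u)+\omega(D,d)+\epsilon,$$ where $\epsilon=1$ if $u$ is prime and $d\in D^\times$, and $\epsilon=0$ otherwise. In particular, $\omega(H,(u,d))<\infty$ if and only if $\omega(H_0,u)<\infty$ and $\omega(D,d)<\infty$, and if $D$ is not a group, then $\omega(H)=\infty$ and $\mathsf t(H)=\infty$. 5. Suppose $H_0$ is atomic, $D$ is a group, and let $d\in D$. If $u\in\mathcal A(H_0)$ is a prime element, then $$\omega(H,(u,d))=2,\quad\tau(H,(u,d))=1,\quad\mathsf t(H,(u,d)H^\times)=2.$$ If $u\in\mathcal A(H_0)$ is not a prime element, then $$\omega(H,(u,d))=\omega(H_0,u),\quad\tau(H,(u,d))=\tau(H_0,u),\quad\mathsf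 t(H,(u,d)H^\times)=\mathsf t(H_0,uH_0^\times).$$ In particular, $\mathsf t(H)=\max\{2,\mathsf t(H_0)\}$, $\omega(H)=\max\{2,\omega(H_0)\}$ and $\tau(H)=\max\{1,\tau(H_0)\}$. 6. Suppose $H_0$ and $D$ are atomic. Let $d\in D$ and $a\in H_0\setminus(\mathcal A(H_0)\cup H_0^\times)$. Then $\mathsf c_H((a,d))=0$ if (i) $D^\times=\{1,d\}$, and $\mathsf Z_{H_0}(a)=\{(uH_0^\times)^2\}$ for some $u\in\mathcal A(H_0)$, or (ii) $D$ is reduced, $d=1$ and $\mathsf c_{H_0}(a)=0$, or (iii) $D$ is reduced, $d\in\mathcal A(D)$ and $\mathsf Z_{H_0}(a)=\{(uH_0^\times)^k\}$ for some $u\in\mathcal A(H_0)$ and an integer $k\ge 2$. In any other case, $\mathsf c_H((a,d))=\max\{2,\mathsf c_{H_0}(a)\}$. In particular, $\mathsf c(H)=\max\{2,\mathsf c(H_0)\}$.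
   Context: A monoid is a commutative cancellative semigroup with identity (written multiplicatively). For a monoid $S$: $S^\times$ is the unit group, $S$ is reduced if $S^\times=\{1\}$, $S_{\mathrm{red}}=\{aS^\times:a\in S\}$, $\mathsf q(S)$ is the quotient group, $\mathcal A(S)$ is the set of atoms (non-units $u$ such that $u=ab$ implies $a$ or $b$ is a unit), and $S$ is atomic if every element is, up to a unit, a product of atoms. $a\simeq b$ means associated. The complete integral closure is $\widehat S=\{x\in\mathsf q(S):\exists c\in S,\ cx^n\in S\ \forall n\in\mathbb N\}$; $S$ is completely integrally closed if $S=\widehat S$. A submonoid $S\subset T$ is saturated if for $a,b\in S$, $a\mid b$ in $T$ implies $a\mid b$ in $S$. A Krull monoid is one admitting a homomorphism $\varphi$ to a free abelian monoid such that $\varphi(a)\mid\varphi(b)$ implies $a\mid b$. A homomorphism $\theta:S\to B$ is a transfer homomorphism if (T1) $B=\theta(S)B^\times$ and $\theta^{-1}(B^\times)=S^\times$; (T2) if $u\in S$, $b,c\in B$ and $\theta(u)=bc$, then there are $v,w\in S$ with $u=vw$, $\theta(v)\simeq b$, $\theta(w)\simeq c$. Factorizations: $\mathsf Z(S)$ is the free abelian monoid on $\mathcal A(S_{\mathrm{red}})$; $\mathsf Z_S(a)$ is the set of $z\in\mathsf Z(S)$ with product $aS^\times$; $|z|$ is the length of $z$; $\mathsf L(a)=\{|z|:z\in\mathsf Z_S(a)\}$. $\mathsf d(z,z')=\max\{|z\gcd(z,z')^{-1}|,|z'\gcd(z,z')^{-1}|\}$. $\mathsf c_S(a)$ is the smallest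 $N\in\mathbb N_0\cup\{\infty\}$ such that any two $z,z'\in\mathsf Z_S(a)$ can be joined by a finite chain in $\mathsf Z_S(a)$ with consecutive distances $\le N$; $\mathsf c(S)=\sup_a\mathsf c_S(a)$. For $S$ atomic and $a\in S$: $\omega(S,a)$ is the smallest $N\in\mathbb N_0\cup\{\infty\}$ such that for any multiple $b$ of $a$ and any factorization $b=v_1\cdots v_n$ into atoms (up to units), there is $\Omega\subset[1,n]$ with $|\Omega|\le N$ and $a\mid\prod_{\nu\in\Omega}v_\nu$; $\omega(S)=\sup\{\omega(S,u):u\in\mathcal A(S)\}$. $\tau(S,a)=\sup\{\min\mathsf L(a^{-1}b): b=u_1\cdots u_k\in aS,\ k\in\mathbb N_0,\ u_1,\ldots,u_k\in\mathcal A(S),\ a\nmid u_i^{-1}b\text{ for all }i\in[1,k]\}$; $\tau(S)=\sup\{\tau(S,u):u\in\mathcal A(S)\}$. For an atom $u\in S_{\mathrm{red}}$, $\mathsf t(S,u)$ is the smallest $N\in\mathbb N_0\cup\{\infty\}$ such that for every multiple $a\in S_{\mathrm{red}}$ of $u$ and every factorization $v_1\cdots v_n$ of $a$ not containing $u$, there is (after renumbering) a subproduct $v_1\cdots v_m$ which is a multiple of $u$ and a refactorization $v_1\cdots v_m=uu_2\cdots u_\ell$ into atoms with $\max\{\ell,m\}\le N$; $\mathsf t(S)=\sup_u\mathsf t(S,u)$. *)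

(* Defs.v *)
From HB Require Import structures.
From mathcomp Require Import all_boot.
From mathcomp Require Import boolp classical_sets.
From mathcomp Require Import finmap multiset.

Set Implicit Arguments.
Unset Strict Implicit.
Unset Printing Implicit Defensive.

Local Open Scope group_scope.
Local Open Scope quotient_scope.

Inductive enat := Fin of nat | Infty.

Definition enat_le (x y : enat) : bool :=
  match x, y with
  | _, Infty => true
  | Infty, Fin _ => false
  | Fin m, Fin n => (m <= n)%N
  end.

Definition enat_max (x y : enat) : enat := if enat_le x y then y else x.

Definition enat_add (x y : enat) : enat :=
  if x is Fin m then (if y is Fin n then Fin (m + n)%N else Infty) else Infty.

Definition enat_min (P : nat -> Prop) : enat :=
  if pselect (exists n, `[< P n >]) is left h then Fin (ex_minn h) else Infty.

(* the least upper bound in N_0 u {oo}: the empty supremum is 0 *)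
Definition enat_sup (A : set enat) : enat :=
  enat_min (fun n => forall x, A x -> enat_le x (Fin n)).

HB.mixin Record Monoid_isCommCancel S of Monoid S := {
  cmulgC : commutative (@mul S);
  cmulgI : right_injective (@mul S)
}.

#[short(type="cmonoidType")]
HB.structure Definition CMonoid := {S of Monoid_isCommCancel S & Monoid S}.

HB.instance Definition _ (S : cmonoidType) :=
  SemiGroup.isCommutativeLaw.Build S (@mul S) (@cmulgC S).

Section ProductMonoid.
Variables S T : cmonoidType.

Fact pair_cmulgC : commutative (@mul (S * T)%type).
Proof. by case=> a b [c d]; congr pair; exact: cmulgC. Qed.

Fact pair_cmulgI : right_injective (@mul (S * T)%type).
Proof. by case=> a b [c d] [e f] [/cmulgI -> /cmulgI ->]. Qed.

HB.instance Definition _ :=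
  Monoid_isCommCancel.Build (S * T)%type pair_cmulgC pair_cmulgI.
End ProductMonoid.

(* {mset P} is the free abelian monoid on P *)
Section FreeAbelianMonoid.
Variable P : choiceType.

Fact mset_mulA : associative (@msetD P).
Proof. by move=> A B C; rewrite msetDA. Qed.
Fact mset_mul1 : left_id mset0 (@msetD P).
Proof. exact: mset0D. Qed.
Fact mset_mulr1 : right_id mset0 (@msetD P).
Proof. exact: msetD0. Qed.

HB.instance Definition _ :=
  Choice.copy {mset P}%mset {fsfun P -> nat with 0%N}%fset.
HB.instance Definition _ := isMonoid.Build {mset P}%mset
  mset_mulA mset_mul1 mset_mulr1.

Fact mset_cmulgC : commutative (@mul {mset P}%mset).
Proof. exact: msetDC. Qed.
Fact mset_cmulgI : right_injective (@mul {mset P}%mset).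
Proof. by move=> A B C /(congr1 (msetB^~ A)); rewrite !msetDKB. Qed.

HB.instance Definition _ :=
  Monoid_isCommCancel.Build {mset P}%mset mset_cmulgC mset_cmulgI.
End FreeAbelianMonoid.

Section Divisibility.
Variable S : cmonoidType.
Implicit Types a b u : S.

Definition munit : {pred S} := fun a => `[< exists b, a * b = 1 >].

Definition is_group : Prop := forall a, a \in munit.

Definition reduced : Prop := forall a, a \in munit -> a = 1.

Definition mdvd a b : Prop := exists c, b = a * c.

Definition associated a b : Prop := exists2 e, e \in munit & b = a * e.

Definition atom u : Prop :=
  u \notin munit /\ forall a b, u = a * b -> a \in munit \/ b \in munit.

Definition mprime u : Prop :=
  u \notin munit /\ forall a b, mdvd u (a * b) -> mdvd u a \/ mdvd u b.

Definition atomic : Prop := forall a, exists s : seq S,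
  (forall u, u \in s -> atom u) /\ associated a (\prod_(u <- s) u).

End Divisibility.
Arguments munit {S}.
Arguments is_group S : clear implicits.
Arguments reduced S : clear implicits.
Arguments atomic S : clear implicits.

Section Reduced.
Variable S : cmonoidType.
Implicit Types a b c : S.

Lemma munitP a : reflect (exists b, a * b = 1) (a \in munit).
Proof. exact: asboolP. Qed.

Lemma munit1 : (1 : S) \in munit.
Proof. by apply/munitP; exists 1; rewrite mulg1. Qed.

Lemma munitM a b : (a * b \in munit) = (a \in munit) && (b \in munit).
Proof.
apply/idP/andP => [/munitP[c abc]|[/munitP[a' aa'] /munitP[b' bb']]].
  split; apply/munitP; first by exists (b * c); rewrite mulgA.
  by exists (a * c); rewrite mulgA [b * a]cmulgC.
by apply/munitP; exists (b' * a'); rewrite mulgA -(mulgA a) bb' mulg1.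
Qed.

Definition assocb a b : bool := `[< associated a b >].

Lemma assocb_refl : reflexive assocb.
Proof.
by move=> a; apply/asboolP; exists 1; rewrite ?mulg1 //; exact: munit1.
Qed.

Lemma assocb_sym : symmetric assocb.
Proof.
suff h a b : assocb a b -> assocb b a by move=> a b; apply/idP/idP; exact: h.
move=> /asboolP[e /munitP[f ef] ->]; apply/asboolP; exists f.
  by apply/munitP; exists e; rewrite cmulgC.
by rewrite -mulgA ef mulg1.
Qed.

Lemma assocb_trans : transitive assocb.
Proof.
move=> b a c /asboolP[e he ->] /asboolP[f hf ->]; apply/asboolP.
by exists (e * f); rewrite ?mulgA // munitM he.
Qed.

Canonical assoc_equiv := EquivRel assocb assocb_refl assocb_sym assocb_trans.

Definition red : Type := {eq_quot assoc_equiv}.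
HB.instance Definition _ := EqQuotient.on red.
HB.instance Definition _ := Choice.on red.

Definition cls a : red := \pi_red a.

Lemma clsP a b : cls a = cls b <-> associated a b.
Proof.
split=> [/eqmodP /asboolP //|h]; by apply/eqmodP/asboolP.
Qed.

Definition red_mul (x y : red) : red := cls (repr x * repr y).

Lemma clsK (x : red) : cls (repr x) = x.
Proof. exact: reprK. Qed.

Lemma cls_mul a b : red_mul (cls a) (cls b) = cls (a * b).
Proof.
have /clsP[e he ha] := clsK (cls a); have /clsP[f hf hb] := clsK (cls b).
apply/clsP; exists (e * f); first by rewrite munitM he.
by rewrite {1}ha {1}hb -!mulgA; congr mul; rewrite !mulgA (cmulgC e).
Qed.

Lemma red_mulA : associative red_mul.
Proof.
move=> x y z; rewrite -[x]clsK -[y]clsK -[z]clsK.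
by rewrite !cls_mul mulgA.
Qed.

Lemma red_mulC : commutative red_mul.
Proof. by move=> x y; rewrite /red_mul cmulgC. Qed.

Lemma red_mul1 : left_id (cls 1) red_mul.
Proof. by move=> x; rewrite -[x]clsK cls_mul mul1g. Qed.

Lemma red_mulr1 : right_id (cls 1) red_mul.
Proof. by move=> x; rewrite red_mulC red_mul1. Qed.

HB.instance Definition _ := isMonoid.Build red red_mulA red_mul1 red_mulr1.

Fact red_mulI : right_injective (@mul red).
Proof.
move=> x y z; rewrite /mul/=.
rewrite -[x]clsK -[y]clsK -[z]clsK !cls_mul => /clsP[e he].
by rewrite -mulgA => /cmulgI yz; apply/clsP; exists e.
Qed.

HB.instance Definition _ := Monoid_isCommCancel.Build red red_mulC red_mulI.
End Reduced.

Section QuotientGroup.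
Variable S : cmonoidType.

Definition frac_eq (x y : S * S) : bool := x.1 * y.2 == y.1 * x.2.

Lemma frac_eq_refl : reflexive frac_eq.
Proof. by move=> x; exact: eqxx. Qed.

Lemma frac_eq_sym : symmetric frac_eq.
Proof. by move=> x y; rewrite /frac_eq eq_sym. Qed.

Lemma frac_eq_trans : transitive frac_eq.
Proof.
move=> [b b'] [a a'] [c c']; rewrite /frac_eq /= => /eqP ab /eqP bc.
apply/eqP; apply: (@cmulgI _ b'); rewrite mulgA (cmulgC b' a) ab.
by rewrite -mulgA (cmulgC a') mulgA bc (cmulgC c b') -mulgA.
Qed.

Canonical frac_equiv :=
  EquivRel frac_eq frac_eq_refl frac_eq_sym frac_eq_trans.

Definition qgroup : Type := {eq_quot frac_equiv}.
HB.instance Definition _ := EqQuotient.on qgroup.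
HB.instance Definition _ := Choice.on qgroup.

Definition qfrac (a b : S) : qgroup := \pi_qgroup (a, b).

Definition qincl (a : S) : qgroup := qfrac a 1.

Lemma qfracP a b c d : qfrac a b = qfrac c d <-> a * d = c * b.
Proof.
by split=> [/eqmodP /eqP|h] //; apply/eqmodP/eqP.
Qed.

Definition qmul (x y : qgroup) : qgroup :=
  qfrac ((repr x).1 * (repr y).1) ((repr x).2 * (repr y).2).
Definition qinv (x : qgroup) : qgroup := qfrac (repr x).2 (repr x).1.

Lemma qfracK x : qfrac (repr x).1 (repr x).2 = x.
Proof. by rewrite /qfrac -surjective_pairing reprK. Qed.

Lemma qfrac_mul a b c d : qmul (qfrac a b) (qfrac c d) = qfrac (a * c) (b * d).
Proof.
rewrite /qmul; set x := repr _; set y := repr _.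
have /qfracP hx := qfracK (qfrac a b); have /qfracP hy := qfracK (qfrac c d).
rewrite -/x in hx; rewrite -/y in hy; apply/qfracP.
have ac (p q r s : S) : p * q * (r * s) = (p * r) * (q * s).
  by rewrite -!mulgA; congr mul; rewrite !mulgA (cmulgC q).
by rewrite ac hx hy ac.
Qed.

Lemma qfrac_inv a b : qinv (qfrac a b) = qfrac b a.
Proof.
rewrite /qinv; set x := repr _.
have /qfracP hx := qfracK (qfrac a b); rewrite -/x in hx.
by apply/qfracP; rewrite cmulgC -hx cmulgC.
Qed.

Lemma qmulA : associative qmul.
Proof.
by move=> x y z; rewrite -[x]qfracK -[y]qfracK -[z]qfracK !qfrac_mul !mulgA.
Qed.

Lemma qmulC : commutative qmul.
Proof.
by move=> x y; rewrite -[x]qfracK -[y]qfracK !qfrac_mul; congr qfrac;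
  exact: cmulgC.
Qed.

Lemma qmul1 : left_id (qincl 1) qmul.
Proof. by move=> x; rewrite -[x]qfracK qfrac_mul !mul1g. Qed.

Lemma qmulr1 : right_id (qincl 1) qmul.
Proof. by move=> x; rewrite qmulC qmul1. Qed.

Lemma qmulV : left_inverse (qincl 1) qinv qmul.
Proof.
move=> x; rewrite -[x]qfracK qfrac_inv qfrac_mul; apply/qfracP.
by rewrite mulg1 mul1g cmulgC.
Qed.

Lemma qmulrV : right_inverse (qincl 1) qinv qmul.
Proof. by move=> x; rewrite qmulC qmulV. Qed.

HB.instance Definition _ :=
  isGroup.Build qgroup qmulA qmul1 qmulr1 qmulV qmulrV.

Definition cic : set qgroup :=
  [set x | exists c : S, forall n, exists s : S, qincl c * x ^+ n = qincl s].

Definition completely_integrally_closed : Prop := cic = range qincl.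

Definition krull : Prop :=
  exists (P : choiceType) (phi : S -> {mset P}%mset),
    monoid_morphism phi /\ forall a b, mdvd (phi a) (phi b) -> mdvd a b.

End QuotientGroup.

Arguments qgroup S : clear implicits.
Arguments cic S : clear implicits.
Arguments completely_integrally_closed S : clear implicits.
Arguments krull S : clear implicits.

Definition saturated (T : cmonoidType) (A : {pred T}) : Prop :=
  forall a b, a \in A -> b \in A -> mdvd a b ->
    exists2 c, c \in A & b = a * c.

Definition transfer_hom (S B : cmonoidType) (theta : S -> B) : Prop :=
  [/\ monoid_morphism theta,
      forall b : B, exists s e, e \in munit /\ b = theta s * e,
      forall s, (theta s \in munit) = (s \in munit)
    & forall (u : S) (b c : B), theta u = b * c ->
        exists v w, [/\ u = v * w, associated (theta v) b
                      & associated (theta w) c]].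

Section Factorizations.
Variable S : cmonoidType.

(* Z(S), the free abelian monoid on the atoms of S_red, realized as the
   multisets on S_red all of whose elements are atoms *)
Definition factorizations : set {mset red S}%mset :=
  [set z | forall u, u \in z -> atom u].

Definition fprod (z : {mset red S}%mset) : red S := \prod_(u <- z) u.

Definition Zof (a : S) : set {mset red S}%mset :=
  [set z | factorizations z /\ fprod z = cls a].

Definition lengths (a : S) (n : nat) : Prop :=
  exists2 z, Zof a z & size z = n.

Definition fdist (z z' : {mset red S}%mset) : nat :=
  maxn (size (z `\` (z `&` z'))%mset) (size (z' `\` (z `&` z'))%mset).

Definition cat_deg (a : S) : enat :=
  enat_min (fun N => forall z z', Zof a z -> Zof a z' ->
    exists s : seq {mset red S}%mset,
      [/\ forall y, y \in s -> Zof a y,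
          path (fun x y => (fdist x y <= N)%N) z s
        & last z s = z']).

Definition cat_degS : enat :=
  enat_sup [set x | exists a, x = cat_deg a].

Definition omega (a : S) : enat :=
  enat_min (fun N => forall (b : S) (n : nat) (v : 'I_n -> S),
    mdvd a b -> (forall i, atom (v i)) -> associated b (\prod_(i < n) v i) ->
    exists Omega : {set 'I_n},
      (#|Omega| <= N)%N /\ mdvd a (\prod_(i in Omega) v i)).

Definition omegaS : enat :=
  enat_sup [set x | exists2 u, atom u & x = omega u].

(* the product of the u_i is b, and c is a^-1 b *)
Definition tau (a : S) : enat :=
  enat_sup [set x | exists (c : S) (k : nat) (u : 'I_k -> S),
    [/\ forall i, atom (u i),
        \prod_(i < k) u i = a * c,
        forall i, ~ mdvd a (\prod_(j < k | j != i) u j)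
      & x = enat_min (lengths c)]].

Definition tauS : enat :=
  enat_sup [set x | exists2 u, atom u & x = tau u].

(* z is the multiset of v_1, .., v_n, z1 that of v_1, .., v_m and z2 that of
   u_2, .., u_l *)
Definition tame (u : red S) : enat :=
  enat_min (fun N => forall (a : red S) (z : {mset red S}%mset),
    mdvd u a -> factorizations z -> fprod z = a -> u \notin z ->
    exists z1 z2 : {mset red S}%mset,
      [/\ (z1 `<=` z)%mset, factorizations z2, fprod z1 = u * fprod z2
        & (maxn (size z2).+1 (size z1) <= N)%N]).

Definition tameS : enat :=
  enat_sup [set x | exists2 u, atom u & x = tame u].

End Factorizations.

Arguments cat_degS S : clear implicits.
Arguments omegaS S : clear implicits.
Arguments tauS S : clear implicits.
Arguments tameS S : clear implicits.

Section Propto.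
Variables H0 D : cmonoidType.

Definition propto_pred : {pred H0 * D} :=
  [pred x | (x.1 \notin munit) || ((x.1 \in munit) && (x.2 == 1))].

Fact propto_closed : monoid_closed propto_pred.
Proof.
split; first by rewrite !inE /= munit1 eqxx orbT.
move=> [a d] [b e]; rewrite !inE /= munitM.
case: (a \in munit) => //=; case: (b \in munit) => //= /eqP-> /eqP->.
by rewrite mulg1.
Qed.

Record propto : Type := Propto {
  propto_val : H0 * D;
  propto_valP : propto_val \in propto_pred }.

HB.instance Definition _ := [isSub for propto_val].
HB.instance Definition _ := [Choice of propto by <:].
HB.instance Definition _ :=
  SubChoice_isSubMonoid.Build _ _ propto propto_closed.

Fact propto_mulC : commutative (@mul propto).
Proof. by move=> x y; apply: val_inj; rewrite !valM cmulgC. Qed.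
Fact propto_mulI : right_injective (@mul propto).
Proof.
by move=> x y z /(congr1 val); rewrite !valM => /cmulgI /val_inj.
Qed.
HB.instance Definition _ :=
  Monoid_isCommCancel.Build propto propto_mulC propto_mulI.

Fact propto_pair_subproof a d : a \notin munit -> (a, d) \in propto_pred.
Proof. by move=> ha; rewrite inE /= ha. Qed.

Definition propto_pair (a : H0) (d : D) (ha : a \notin munit) : propto :=
  Propto (propto_pair_subproof d ha).

Definition atom_nonunit (u : H0) (hu : atom u) : u \notin munit := proj1 hu.

Definition propto_fst (x : propto) : H0 := (val x).1.

End Propto.

(* Main.v *)
(** In [H] the element [(u, d)] divides [(b, e)] iff [u] divides [b], [d] divides
  [e], and either the quotient [b / u] is a non-unit or [d = e]. So divisibility
  in both components lifts to [H] once an extra non-unit factor is left over,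
  at the price of at most one more atom; and a factorization of [a] lifts to
  one of [(a, d)] by placing [d] on any single factor. Two lifts of the same
  factorization are joined by steps moving a second component from one factor
  to another, which is where the constant [2] comes from. As units of [H] have
  second component [1], [H_red] projects to [(H_0)_red] and to [D] itself, and
  the same arguments apply to [H] and to [H_red]. *)

Require Import Defs.
From HB Require Import structures.
From mathcomp Require Import all_boot.
From mathcomp Require Import boolp classical_sets functions.
From mathcomp Require Import finmap multiset.
From Stdlib Require Import Relation_Operators.

Set Implicit Arguments.
Unset Strict Implicit.
Unset Printing Implicit Defensive.

Local Open Scope group_scope.

(** * Extended natural numbers and monoids *)

(** The lower bounds rest on a failure of divisibility: [(u, d)] divides [(u, e)] only if [d = e].
    If [D] is a non-trivial group and [e <> d], then [(u, d)] divides the square of [(u, e)] but not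
    [(u, e)] itself, even for prime [u]; this gives 2 for omega and the tame degree and 1 for tau.
    If [D] has an atom [v], a product of factors [(u, v)] divisible by [(u, v ^+ n)] needs at least
    [n] of them, so omega and the tame degree are unbounded. An obstacle on the side of [D] is that
    second components of atoms of [H] are arbitrary elements of [D], while omega in [D] only tests
    products of atoms. For the catenary degree, distinct factorizations of one element are never at
    distance 1, so the value is 0 or at least 2, and 0 means unique factorization. The three
    exceptional cases are those in which [a] has one factorization and all ways of distributing [d]
    over it give the same multiset. *)

Section ExtendedNat.
Implicit Types (x y z : enat) (n : nat) (P : nat -> Prop) (A : set enat).

Lemma enat_le_refl x : enat_le x x.
Proof. by case: x => //= n. Qed.

Lemma enat_le_trans y x z : enat_le x y -> enat_le y z -> enat_le x z.
Proof. by case: x y z => [m|] [n|] [k|] //=; apply: leq_trans. Qed.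

Lemma enat_le_anti x y : enat_le x y -> enat_le y x -> x = y.
Proof.
by case: x y => [m|] [n|] //= mn nm; congr Fin; apply/eqP; rewrite eqn_leq mn.
Qed.

Lemma enat_leInfty x : enat_le x Infty.
Proof. by case: x. Qed.

Lemma enat_Infty_le x : enat_le Infty x -> x = Infty.
Proof. by case: x. Qed.

Lemma enat_0le x : enat_le (Fin 0) x.
Proof. by case: x. Qed.

Lemma enat_le_total x y : enat_le x y || enat_le y x.
Proof. by case: x y => [m|] [n|] //=; apply: leq_total. Qed.

Lemma enat_max_le x y z : enat_le (enat_max x y) z = enat_le x z && enat_le y z.
Proof.
rewrite /enat_max; case: ifPn => [xy|nxy]; apply/idP/andP => [h|[]//].
  by split=> //; apply: enat_le_trans h.
split=> //; apply: enat_le_trans h.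
by have := enat_le_total x y; rewrite (negPf nxy).
Qed.

Lemma enat_le_maxl x y : enat_le x (enat_max x y).
Proof. by have := enat_le_refl (enat_max x y); rewrite enat_max_le => /andP[]. Qed.

Lemma enat_le_maxr x y : enat_le y (enat_max x y).
Proof. by have := enat_le_refl (enat_max x y); rewrite enat_max_le => /andP[]. Qed.

(** Invariants are compared through their finite upper bounds: each [N] bounding the one is shown to
    bound the other, and infinite values take care of themselves. *)
Lemma enat_le_ext x y :
  (forall n, enat_le y (Fin n) -> enat_le x (Fin n)) -> enat_le x y.
Proof. by case: y => [n|] h; [apply: h; exact: enat_le_refl | exact: enat_leInfty]. Qed.

Lemma enat_minP P n : (forall m k, P m -> (m <= k)%N -> P k) ->
  enat_le (enat_min P) (Fin n) <-> P n.
Proof.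
move=> Pmono; rewrite /enat_min; case: pselect => [h|h] /=; last first.
  by split=> // Pn; case: h; exists n; apply/asboolP.
case: ex_minnP => m /asboolP Pm mP; split=> [|Pn]; first exact: Pmono.
by apply: mP; apply/asboolP.
Qed.

Lemma enat_min_le P n : P n -> enat_le (enat_min P) (Fin n).
Proof.
move=> Pn; rewrite /enat_min; case: pselect => [h|h] /=; last first.
  by case: h; exists n; apply/asboolP.
by case: ex_minnP => m _; apply; apply/asboolP.
Qed.

Lemma enat_le_min P x :
  (forall n, P n -> enat_le x (Fin n)) -> enat_le x (enat_min P).
Proof.
move=> xP; rewrite /enat_min; case: pselect => [h|h] /=; last exact: enat_leInfty.
by case: ex_minnP => m /asboolP /xP.
Qed.

Lemma eq_enat_min P Q : (forall n, P n <-> Q n) -> enat_min P = enat_min Q.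
Proof. by move=> h; congr enat_min; apply/funext => n; apply/propext. Qed.

Lemma enat_sup_le A x : enat_le (enat_sup A) x <-> forall y, A y -> enat_le y x.
Proof.
case: x => [n|]; last by split=> [_ y _|_]; apply: enat_leInfty.
apply: enat_minP => m k mA mk x /mA xm; exact: (enat_le_trans xm).
Qed.

Lemma enat_le_sup A x : A x -> enat_le x (enat_sup A).
Proof. by move=> Ax; move/enat_sup_le: (enat_le_refl (enat_sup A)); apply. Qed.

Lemma enat_sup_Infty A :
  (forall n, exists2 x, A x & ~ enat_le x (Fin n)) -> enat_sup A = Infty.
Proof.
move=> hA; case e: enat_sup => [n|//]; case: (hA n) => x Ax; case.
by rewrite -e; apply: enat_le_sup.
Qed.

End ExtendedNat.

(** Common form of the formulas for [omegaS], [tauS] and [tameS] over a group [D]: [pr] maps the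
    atoms of [H] onto those of [H_0], and [k] is the lower bound 2 or 1. An atom must exist, since
    an empty supremum is 0. *)
Lemma enat_sup_proj (A B : Type) (f : A -> enat) (g : B -> enat) (P : A -> Prop)
    (Q : B -> Prop) (pr : A -> B) k :
  (exists x, P x) -> (forall x, P x -> Q (pr x)) ->
  (forall u, Q u -> exists2 x, P x & pr x = u) ->
  (forall x, P x -> enat_le k (f x)) ->
  (forall x, P x -> enat_le (g (pr x)) (f x)) ->
  (forall x, P x -> enat_le (f x) (enat_max k (g (pr x)))) ->
  enat_sup [set y | exists2 x, P x & y = f x]%classic
  = enat_max k (enat_sup [set y | exists2 u, Q u & y = g u]%classic).
Proof.
move=> [x0 Px0] PQ QP kf gf fg; apply: enat_le_anti.
  apply/enat_sup_le => _ [x Px ->]; apply: enat_le_trans (fg x Px) _.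
  rewrite enat_max_le enat_le_maxl /=; apply: enat_le_trans (enat_le_maxr _ _).
  by apply: enat_le_sup; exists (pr x) => //; apply: PQ.
rewrite enat_max_le; apply/andP; split.
  by apply: enat_le_trans (kf x0 Px0) _; apply: enat_le_sup; exists x0.
apply/enat_sup_le => _ [u /QP[x Px <-] ->]; apply: enat_le_trans (gf x Px) _.
by apply: enat_le_sup; exists x.
Qed.

Section MonoidFacts.
Variable S : cmonoidType.
Implicit Types (a b c u v : S) (s t : seq S).

Lemma mulgIc a b c : b * a = c * a -> b = c.
Proof. by rewrite !(cmulgC _ a); apply: cmulgI. Qed.

Lemma mdvd_refl a : mdvd a a.
Proof. by exists 1; rewrite mulg1. Qed.

Lemma mdvd_trans b a c : mdvd a b -> mdvd b c -> mdvd a c.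
Proof. by move=> [x ->] [y ->]; exists (x * y); rewrite mulgA. Qed.

Lemma mdvd_mulr a b c : mdvd a b -> mdvd a (b * c).
Proof. by move=> [x ->]; exists (x * c); rewrite mulgA. Qed.

Lemma mdvd_mull a b c : mdvd a b -> mdvd a (c * b).
Proof. by rewrite cmulgC; apply: mdvd_mulr. Qed.

Lemma mdvd_mem a s : a \in s -> mdvd a (\prod_(x <- s) x).
Proof. by move=> sa; rewrite (big_rem a sa) /=; apply/mdvd_mulr/mdvd_refl. Qed.

Lemma mdvd_munit a b : b \in munit -> mdvd a b -> a \in munit.
Proof. by move=> ub [c e]; move: ub; rewrite e munitM => /andP[]. Qed.

Lemma munit_mdvd a b : a \in munit -> mdvd a b.
Proof. by move=> /munitP[c ac]; exists (c * b); rewrite mulgA ac mul1g. Qed.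

Lemma associated_refl a : associated a a.
Proof. by exists 1; rewrite ?mulg1 // munit1. Qed.

Lemma associated_sym a b : associated a b -> associated b a.
Proof.
move=> [e /munitP[f ef] ->]; exists f; last by rewrite -mulgA ef mulg1.
by apply/munitP; exists e; rewrite cmulgC.
Qed.

Lemma associated_dvd a b : associated a b -> mdvd a b.
Proof. by move=> [e _ ->]; exists e. Qed.

Lemma associated_munit a b : associated a b -> (a \in munit) = (b \in munit).
Proof. by move=> [e ue ->]; rewrite munitM ue andbT. Qed.

Lemma atomMunit u e : atom u -> e \in munit -> atom (u * e).
Proof.
move=> [nu uP] ue; split; first by rewrite munitM negb_and nu.
move=> a b uab; have /munitP[f ef] := ue.
have: u = a * (b * f) by rewrite mulgA -uab -mulgA ef mulg1.
by move/uP => [|]; [left | rewrite munitM => /andP[? _]; right].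
Qed.

Lemma prod_munit s :
  (\prod_(x <- s) x \in munit) = all (fun x => x \in munit) s.
Proof.
elim: s => [|a s IHs]; first by rewrite big_nil munit1.
by rewrite big_cons munitM IHs.
Qed.

Lemma prod_atoms_munit s : (forall v, v \in s -> atom v) ->
  \prod_(x <- s) x \in munit -> s = [::].
Proof.
case: s => // a s sA; rewrite big_cons munitM => /andP[ua].
by have [/negP] := sA a (mem_head _ _).
Qed.

Lemma atom_dvd_assoc u v : u \notin munit -> atom v -> mdvd u v -> associated u v.
Proof.
by move=> nu [nv vP] [c e]; have [uu|uc] := vP _ _ e; [rewrite uu in nu | exists c].
Qed.

Lemma atom_eq_prod u s e : atom u -> (forall v, v \in s -> atom v) ->
  e \in munit -> \prod_(x <- s) x = u * e -> exists2 v, s = [:: v] & v = u * e.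
Proof.
move=> Au sA ue; case: s sA => [|v s] sA.
  move=> eq1; have : u * e \in munit by rewrite -eq1 big_nil munit1.
  by rewrite munitM => /andP[uu _]; case: Au => /negP.
rewrite big_cons => eq1; have [_ uP] := atomMunit Au ue.
have [/negP nv _] := sA v (mem_head _ _).
have [//|us] := uP _ _ (esym eq1).
have s0 : s = [::].
  by apply: prod_atoms_munit us => w ws; apply: sA; rewrite inE ws orbT.
by exists v; [rewrite s0 | rewrite -eq1 s0 big_nil mulg1].
Qed.

Lemma prime_dvd_prod u s : mprime u -> mdvd u (\prod_(x <- s) x) ->
  exists2 v, v \in s & mdvd u v.
Proof.
move=> [nu uP]; elim: s => [|a s IHs].
  by rewrite big_nil => /(mdvd_munit (munit1 S)) uu; rewrite uu in nu.
rewrite big_cons => /uP[ua|/IHs[v vs uv]]; first by exists a; rewrite ?mem_head.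
by exists v; rewrite // inE vs orbT.
Qed.

Lemma atomic_exists_atom : atomic S -> ~ is_group S -> exists u : S, atom u.
Proof.
move=> Sat nG; apply: contrapT => nA; apply: nG => a.
have [[|u s] [sA [e ue eq1]]] := Sat a; last by case: nA; exists u; apply/sA/mem_head.
by apply/munitP; exists e; rewrite -eq1 big_nil.
Qed.

(* A unit absorbs into the first atom, so only units lack an exact factorization. *)
Lemma atomic_prod a : atomic S -> a \notin munit ->
  exists2 s, (forall v, v \in s -> atom v) & a = \prod_(x <- s) x.
Proof.
move=> /(_ a)[[|u s] [sA /associated_sym[e ue ->]]].
  by rewrite big_nil mul1g ue.
move=> _; exists ((u * e) :: s).
  move=> v; rewrite inE => /orP[/eqP->|vs]; last by apply: sA; rewrite inE vs orbT.
  by apply: atomMunit => //; apply/sA/mem_head.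
by rewrite !big_cons -!mulgA (cmulgC e).
Qed.

(** Two elements witness that [u] is not prime; refining both into atoms keeps [u] from dividing any
    factor. Such sequences give the lower bounds for non-prime [u]. *)
Lemma nonprime_dvd_prod u : atomic S -> atom u -> ~ mprime u ->
  exists s, [/\ forall v, v \in s -> atom v, mdvd u (\prod_(x <- s) x)
                & forall v, v \in s -> ~ mdvd u v].
Proof.
move=> Sat [nu uP] npu.
have [a [b [uab nua nub]]] : exists a b, [/\ mdvd u (a * b), ~ mdvd u a & ~ mdvd u b].
  apply: contrapT => h; apply: npu; split=> // a b uab.
  apply: contrapT => /not_orP[nua nub]; apply: h; by exists a, b.
have nunit x y : mdvd u (x * y) -> ~ mdvd u y -> x \notin munit.
  move=> uxy nuy; apply/negP => /munitP[x' xx']; apply: nuy.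
  have := mdvd_mull x' uxy; by rewrite mulgA [x' * x]cmulgC xx' mul1g.
have [s sA sE] := atomic_prod Sat (nunit _ _ uab nub).
have uba : mdvd u (b * a) by rewrite cmulgC.
have [t tA tE] := atomic_prod Sat (nunit _ _ uba nua).
exists (s ++ t); split.
- by move=> v; rewrite mem_cat => /orP[/sA|/tA].
- by rewrite big_cat -sE -tE.
move=> v; rewrite mem_cat => /orP[] vs uv; [apply: nua | apply: nub].
  by rewrite sE; apply: mdvd_trans uv (mdvd_mem vs).
by rewrite tE; apply: mdvd_trans uv (mdvd_mem vs).
Qed.

Lemma mulgACA : @interchange S mul mul.
Proof. by move=> a b c d; rewrite -!mulgA; congr mul; rewrite !mulgA (cmulgC b). Qed.

Lemma prod_map_expg s a : all (pred1 a) s -> \prod_(x <- s) x = a ^+ size s.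
Proof.
elim: s => [|b s IHs]; first by rewrite big_nil.
by rewrite big_cons /= expgS => /andP[/eqP-> /IHs->].
Qed.

Lemma expg_dvd_leq a m n : a \notin munit -> mdvd (a ^+ m) (a ^+ n) -> (m <= n)%N.
Proof.
move=> na [c e]; case: leqP => // nm; move: e; rewrite -(subnKC nm) addSn -addnS.
rewrite expgnDr -[LHS]mulg1 -mulgA => /cmulgI e1; case/negP: na.
by apply/munitP; exists (a ^+ (m - n.+1) * c); rewrite mulgA -expgS.
Qed.

Lemma expg_nonunit a n : a \notin munit -> a ^+ n.+1 \notin munit.
Proof. by move=> na; rewrite expgS munitM negb_and na. Qed.

End MonoidFacts.

Section ReducedMonoid.
Variable S : cmonoidType.
Implicit Types (a b u : S) (x y : red S).

Lemma cls1 : cls (1 : S) = 1.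
Proof. by []. Qed.

Lemma clsM a b : cls (a * b) = cls a * cls b.
Proof. by rewrite -cls_mul. Qed.

Lemma cls_prod (I : Type) (s : seq I) (F : I -> S) :
  cls (\prod_(i <- s) F i) = \prod_(i <- s) cls (F i).
Proof. exact: (big_morph _ clsM cls1). Qed.

Lemma munit_cls a : (cls a \in munit) = (a \in munit).
Proof.
apply/idP/idP => [/munitP[x]|/munitP[b ab]].
  rewrite -[x]clsK -clsM -cls1 => /clsP /associated_munit.
  by rewrite munit1 munitM => /andP[].
by apply/munitP; exists (cls b); rewrite -clsM ab.
Qed.

Lemma munit_repr x : (repr x \in munit) = (x \in munit).
Proof. by rewrite -munit_cls clsK. Qed.

Lemma reduced_red : reduced (red S).
Proof.
move=> x; rewrite -[x]clsK munit_cls => ux; rewrite -cls1.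
by apply/clsP/associated_sym; exists (repr x); rewrite ?mul1g.
Qed.

Lemma mdvd_cls a b : mdvd (cls a) (cls b) <-> mdvd a b.
Proof.
split=> [[x]|[c ->]]; last by exists (cls c); rewrite clsM.
rewrite -[x]clsK -clsM => /clsP/associated_sym/associated_dvd.
by apply: mdvd_trans; apply/mdvd_mulr/mdvd_refl.
Qed.

Lemma atom_cls u : atom (cls u) <-> atom u.
Proof.
split=> -[nu uP]; split; rewrite ?munit_cls // in nu *.
  by move=> a b e; have := uP (cls a) (cls b); rewrite !munit_cls -clsM e; apply.
move=> x y; rewrite -[x]clsK -[y]clsK -clsM => /clsP /associated_sym[e /= ue ue1].
rewrite !munit_cls; have := uP (repr x) (repr y * e); rewrite mulgA munitM.
by case/(_ ue1) => [|/andP[]]; [left|right].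
Qed.

Lemma atom_repr x : atom x -> atom (repr x).
Proof. by rewrite -{1}[x]clsK => /atom_cls. Qed.

Lemma mprime_cls u : mprime u -> mprime (cls u).
Proof.
move=> [nu uP]; split; first by rewrite munit_cls.
by move=> x y; rewrite -[x]clsK -[y]clsK -clsM => /mdvd_cls/uP[] /mdvd_cls; [left|right].
Qed.

End ReducedMonoid.

(** * Invariants in terms of sequences of atoms *)

Definition atoms (M : cmonoidType) (s : seq M) := forall v, v \in s -> atom v.

Section SequenceCriteria.
Variable S : cmonoidType.
Implicit Types (a b c u v : S) (s t : seq S).

(** A bit mask stands for the index set, so that equal atoms at different places stay distinct and
    selections commute with [map]. *)
Definition omega_bound a N := forall s, atoms s -> mdvd a (\prod_(x <- s) x) ->
  exists m, [/\ size m = size s, (count id m <= N)%N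
              & mdvd a (\prod_(x <- mask m s) x)].

Lemma prod_mask_set n (v : 'I_n -> S) (A : {set 'I_n}) :
  \prod_(x <- mask [seq i \in A | i <- enum 'I_n] [seq v i | i <- enum 'I_n]) x
  = \prod_(i in A) v i.
Proof. by rewrite -map_mask -filter_mask big_map big_filter big_enum_cond. Qed.

Lemma count_mem_set n (A : {set 'I_n}) :
  count id [seq i \in A | i <- enum 'I_n] = #|A|.
Proof. by rewrite count_map enumT cardE /enum_mem size_filter. Qed.

Lemma omega_leP a N : enat_le (omega a) (Fin N) <-> omega_bound a N.
Proof.
apply: iff_trans.
  apply: enat_minP => m k hm mk b n v ab vA bv.
  by have [A [cA dA]] := hm b n v ab vA bv; exists A; split=> //; apply: leq_trans mk.
split=> [h s sA as_|h b n v ab vA bv].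
  pose v (i : 'I_(size s)) := tnth (in_tuple s) i.
  have sE : [seq v i | i <- enum 'I_(size s)] = s by rewrite map_tnth_enum.
  have pE : \prod_(x <- s) x = \prod_(i < size s) v i.
    by rewrite -{1}sE big_map big_enum.
  have [||A [cA dA]] := h (\prod_(x <- s) x) (size s) v as_.
  - by move=> i; apply/sA/mem_tnth.
  - by rewrite pE; apply: associated_refl.
  exists [seq i \in A | i <- enum 'I_(size s)].
  by rewrite size_map size_enum_ord count_mem_set -[X in mask _ X]sE prod_mask_set.
have [||m [sm cm dm]] := h [seq v i | i <- enum 'I_n].
- by move=> _ /mapP[i _ ->].
- by rewrite big_map big_enum /=; apply: mdvd_trans ab (associated_dvd bv).
rewrite size_map size_enum_ord in sm.
pose A := [set i : 'I_n | nth false m i].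
have mE : m = [seq i \in A | i <- enum 'I_n].
  apply: (@eq_from_nth _ false) => [|i]; first by rewrite sm size_map size_enum_ord.
  rewrite sm => lin.
  by rewrite (nth_map (Ordinal lin)) ?size_enum_ord // inE nth_enum_ord.
by exists A; rewrite -count_mem_set -prod_mask_set -mE.
Qed.

Lemma lengthsP a n : lengths a n <->
  exists s, [/\ atoms s, size s = n & associated a (\prod_(x <- s) x)].
Proof.
split=> [[z [zA zE] <-]|[s [sA <- sE]]].
  exists (map (@repr _ _) z); rewrite size_map; split=> //.
    by move=> _ /mapP[x xz ->]; apply/atom_repr/zA.
  by apply/clsP; rewrite -zE big_map cls_prod; apply: eq_bigr => x _; rewrite clsK.
have pe := perm_eq_seq_mset (map (@cls S) s).
exists (seq_mset (map (@cls S) s)); last by rewrite (perm_size pe) size_map.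
split=> [u|].
  by rewrite (perm_mem pe) => /mapP[x /sA xA ->]; apply/atom_cls.
by rewrite /Defs.fprod (perm_big _ pe) big_map -cls_prod; apply/esym/clsP.
Qed.

(** Here [w] is [u_2, .., u_l], so that [l <= N] reads [size w < N]. *)
Definition tame_bound u N := forall s, atoms s -> mdvd u (\prod_(x <- s) x) ->
  u \notin s -> exists t t' w, [/\ perm_eq s (t ++ t'), atoms w,
    \prod_(x <- t) x = u * \prod_(x <- w) x, (size w < N)%N & (size t <= N)%N].

Definition fac (x : S) s := atoms s /\ \prod_(y <- s) y = x.

(** The common part [g] need not be the gcd, which makes steps easy to build and to transport; by
    [fdist_leP] the relation is still distance at most [N]. *)
Definition fac_step N s t := exists g a b : seq S, [/\ perm_eq s (g ++ a),
  perm_eq t (g ++ b), (size a <= N)%N & (size b <= N)%N].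

(** Only the target of a step is asked to be a factorization of [x]; along a chain that starts at
    one, the sources are too. *)
Definition fac_chain N x := clos_refl_trans (seq S)
  (fun s t => fac x t /\ fac_step N s t).

Lemma fac_perm x s t : perm_eq s t -> fac x s -> fac x t.
Proof.
move=> pst [sA sE]; split; first by move=> v; rewrite -(perm_mem pst); apply: sA.
by rewrite -(perm_big _ pst).
Qed.

Lemma fac_step_perm N s s' t t' :
  perm_eq s s' -> perm_eq t t' -> fac_step N s t -> fac_step N s' t'.
Proof.
move=> ps pt [g [a [b [pa pb sa sb]]]]; exists g, a, b.
by rewrite -(permPl ps) -(permPl pt).
Qed.

Lemma fac_chain_trans N x t s r :
  fac_chain N x s t -> fac_chain N x t r -> fac_chain N x s r.
Proof. exact: rt_trans. Qed.

Lemma fac_chain_step N x s t : fac x t -> fac_step N s t -> fac_chain N x s t.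
Proof. by move=> xt st; apply: rt_step. Qed.

Lemma fac_chain_perm N x s t : fac x s -> perm_eq s t -> fac_chain N x s t.
Proof.
move=> xs pst; apply: fac_chain_step; first exact: fac_perm pst xs.
by exists s, [::], [::]; rewrite cats0 perm_sym.
Qed.

End SequenceCriteria.

Lemma tame_leP (S : cmonoidType) (u : red S) N :
  enat_le (tame u) (Fin N) <-> tame_bound u N.
Proof.
apply: iff_trans.
  apply: enat_minP => m k hm mk a z ua zA zE uz.
  have [z1 [z2 [? ? ? zm]]] := hm a z ua zA zE uz.
  by exists z1, z2; split=> //; apply: leq_trans mk.
split=> [h s sA us uns|h a z ua zA zE uz].
  have pe := perm_eq_seq_mset s.
  have [|||z1 [z2 [zs z2A zE]]] := h (\prod_(x <- s) x) (seq_mset s) us.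
  - by move=> v; rewrite (perm_mem pe); apply: sA.
  - by rewrite /Defs.fprod (perm_big _ pe).
  - by rewrite (perm_mem pe).
  rewrite geq_max => /andP[w2 w1]; exists z1, (seq_mset s `\` z1)%mset, z2.
  split=> //; rewrite -(permPl pe); apply/allP => x _ /=; apply/eqP.
  by rewrite count_cat !count_mem_mset msetE2 subnKC //; apply/msubsetP.
have [|t [t' [w [pt wA tE sw st]]]] := h z zA _ uz.
  by rewrite -[X in mdvd u X]/(Defs.fprod z) zE.
have pet := perm_eq_seq_mset t; have pew := perm_eq_seq_mset w.
exists (seq_mset t), (seq_mset w); split.
- apply/msubsetP => x; rewrite mset_seqE -count_mem_mset (permP pt) count_cat.
  exact: leq_addr.
- by move=> v; rewrite (perm_mem pew); apply: wA.
- by rewrite /Defs.fprod (perm_big _ pet) (perm_big _ pew).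
by rewrite geq_max (perm_size pet) (perm_size pew) sw.
Qed.

Section CatenaryDegree.
Variable S : cmonoidType.
Implicit Types (s t : seq (red S)) (z : {mset red S}%mset).

Lemma ZofP (a : S) z : Zof a z <-> fac (cls a) z.
Proof. by []. Qed.

Lemma fac_ZofP (a : S) s : fac (cls a) s <-> Zof a (seq_mset s).
Proof.
by split=> [|/ZofP]; apply: fac_perm; rewrite ?perm_eq_seq_mset // perm_sym perm_eq_seq_mset.
Qed.

(** Any common part lies below the gcd, so what remains after removing the gcd is a sub-multiset of
    what remains after removing [g]. *)
Lemma fdist_leP N z1 z2 : (fdist z1 z2 <= N)%N <-> fac_step N z1 z2.
Proof.
rewrite /fdist geq_max; split=> [/andP[le1 le2]|[g [a [b [p1 p2 sa sb]]]]].
  exists (z1 `&` z2)%mset, (z1 `\` (z1 `&` z2))%mset, (z2 `\` (z1 `&` z2))%mset.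
  by split=> //; apply/allP => x _ /=; apply/eqP;
    rewrite count_cat !count_mem_mset !msetE2 subnKC // ?geq_minl ?geq_minr.
have aux z s : perm_eq z (g ++ s) -> (size s <= N)%N ->
    (size (z `\` (z1 `&` z2))%mset <= N)%N.
  move=> pz; apply: leq_trans.
  suff /count_subseqP[t ts /perm_size->] :
      forall x, (count_mem x (z `\` (z1 `&` z2))%mset <= count_mem x s)%N.
    exact: size_subseq.
  move=> x; rewrite count_mem_mset !msetE2 -!count_mem_mset (permP pz) (permP p1).
  by rewrite (permP p2) !count_cat leq_subLR leq_add2r leq_min !leq_addr.
by rewrite (aux _ _ p1) // (aux _ _ p2).
Qed.

Lemma cat_leP (a : S) N : enat_le (cat_deg a) (Fin N) <->
  forall s t, fac (cls a) s -> fac (cls a) t -> fac_chain N (cls a) s t.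
Proof.
apply: iff_trans.
  apply: enat_minP => m k hm mk z z' az az'.
  have [p [pa pp pl]] := hm z z' az az'; exists p; split=> //.
  by apply: sub_path pp => x y xy; apply: leq_trans mk.
split=> [h s t as_ at_|h z z' az az'].
  have /fac_ZofP zs := as_; have /fac_ZofP zt := at_.
  have [p [pa pp pl]] := h _ _ zs zt.
  apply: (@fac_chain_trans _ _ _ (seq_mset s)).
    by apply: fac_chain_perm; rewrite // perm_sym perm_eq_seq_mset.
  apply: (@fac_chain_trans _ _ _ (seq_mset t)); last first.
    by apply: fac_chain_perm; rewrite // perm_eq_seq_mset.
  rewrite -pl; elim: p (seq_mset s) pa pp {zs pl} => [|y p IHp] z pa /=.
    by move=> _; apply: rt_refl.
  case/andP=> /fdist_leP zy yp; apply: (@fac_chain_trans _ _ _ y).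
    by apply: fac_chain_step => //; apply/pa/mem_head.
  by apply: IHp => // v vp; apply: pa; rewrite inE vp orbT.
have : fac_chain N (cls a) z z' by apply: h.
suff aux s t : fac_chain N (cls a) s t -> exists p : seq {mset red S}%mset,
    [/\ forall z, z \in p -> Zof a z,
      path (fun x y => (fdist x y <= N)%N) (seq_mset s) p
      & last (seq_mset s) p = seq_mset t].
  by move=> /aux; rewrite !seq_mset_id.
elim=> {s t}[s t [at_ st]|s|r s t _ [p [pa pp pl]] _ [q [qa qp ql]]].
- exists [:: seq_mset t]; split=> //=.
    by move=> y; rewrite inE => /eqP->; apply/(fac_ZofP a t).
  rewrite andbT; apply/fdist_leP.
  by apply: fac_step_perm st; rewrite perm_sym perm_eq_seq_mset.
- by exists [::].
exists (p ++ q); split.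
- by move=> y; rewrite mem_cat => /orP[/pa|/qa].
- by rewrite cat_path pp pl.
by rewrite last_cat pl.
Qed.

End CatenaryDegree.

(** * Pairs of projections and omega *)

Section Masks.
Variable S : cmonoidType.
Implicit Types (a b u v : S) (s t : seq S) (m : bitseq).

Lemma mdvd_mask m s : mdvd (\prod_(x <- mask m s) x) (\prod_(x <- s) x).
Proof.
elim: s m => [|a s IHs] [|[] m] /=; rewrite ?big_nil ?big_cons.
- exact: mdvd_refl.
- exact: mdvd_refl.
- exact: mdvd_refl.
- by exists (a * \prod_(x <- s) x); rewrite mul1g.
- by have [c ->] := IHs m; exists c; rewrite mulgA.
- exact/mdvd_mull.
Qed.

(** Unites the selections made for the two components; the sum of the two omegas in the upper bound
    comes from here. *)
Lemma mask_or s m1 m2 : size m1 = size s -> size m2 = size s ->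
  exists m, [/\ size m = size s, (count id m <= count id m1 + count id m2)%N,
    mdvd (\prod_(x <- mask m1 s) x) (\prod_(x <- mask m s) x)
    & mdvd (\prod_(x <- mask m2 s) x) (\prod_(x <- mask m s) x)].
Proof.
elim: s m1 m2 => [|a s IHs] [|b1 m1] [|b2 m2] //= => [_ _|[s1] [s2]].
  by exists [::]; rewrite !big_nil; split=> //; apply: mdvd_refl.
have [m [sm cm d1 d2]] := IHs _ _ s1 s2.
have dcons b t1 t2 : mdvd (\prod_(x <- t1) x) (\prod_(x <- t2) x) ->
    mdvd (\prod_(x <- b :: t1) x) (\prod_(x <- b :: t2) x).
  by rewrite !big_cons => -[c ->]; exists c; rewrite mulgA.
have dconsr b t1 t2 : mdvd (\prod_(x <- t1) x) (\prod_(x <- t2) x) ->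
    mdvd (\prod_(x <- t1) x) (\prod_(x <- b :: t2) x).
  by rewrite !big_cons; apply: mdvd_mull.
exists ((b1 || b2) :: m); split=> /=; first by rewrite sm.
- by rewrite addnACA leq_add //; case: (b1); case: (b2).
- by case: b1 => //=; [apply: dcons | case: b2 => //; apply: dconsr].
by case: b2 => //=; rewrite ?orbT ?orbF; [apply: dcons | case: b1 => //; apply: dconsr].
Qed.

(** Provides the extra atom that turns a unit quotient into a non-unit. *)
Lemma mask_add1 s m : size m = size s -> (count id m < size s)%N ->
  exists m' z, [/\ size m' = size s, count id m' = (count id m).+1, z \in s
    & \prod_(x <- mask m' s) x = z * \prod_(x <- mask m s) x].
Proof.
elim: s m => [|a s IHs] [|[] m] //= [sm].
  rewrite add1n ltnS => /(IHs _ sm)[m' [z [sm' cm' zs e]]].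
  exists (true :: m'), z; rewrite /= sm' cm' inE zs orbT; split=> //.
  by rewrite !big_cons e !mulgA (cmulgC a).
by exists (true :: m), a; rewrite /= sm mem_head big_cons.
Qed.

Lemma mask_mem s v : v \in s ->
  exists m, [/\ size m = size s, count id m = 1%N & mask m s = [:: v]].
Proof.
elim: s => //= a s IHs; rewrite inE => /orP[/eqP->|/IHs[m [sm cm mE]]].
  exists (true :: nseq (size s) false); rewrite /= size_nseq mask_false.
  by rewrite count_nseq.
by exists (false :: m); rewrite /= sm cm mE.
Qed.

Lemma omega_bound_munit u : u \in munit -> omega_bound u 0.
Proof.
move=> uu s _ _; exists (nseq (size s) false); rewrite size_nseq count_nseq.
by split=> //; apply: munit_mdvd.
Qed.

Lemma omega_bound_prime u : mprime u -> omega_bound u 1.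
Proof.
move=> up s _ /(prime_dvd_prod up)[v vs uv]; have [m [sm cm mE]] := mask_mem vs.
by exists m; rewrite mE cm big_seq1.
Qed.

Lemma omega_bound_ge1 u s N : u \notin munit -> atoms s ->
  mdvd u (\prod_(x <- s) x) -> omega_bound u N -> (0 < N)%N.
Proof.
move=> nu sA us /(_ s sA us)[m [sm cm]]; case: N cm => //.
rewrite leqn0 -(size_mask sm) => /nilP->.
by rewrite big_nil => /(mdvd_munit (munit1 S)) uu; rewrite uu in nu.
Qed.

Lemma omega_bound_ge2 u s N : u \notin munit -> atoms s ->
  mdvd u (\prod_(x <- s) x) -> (forall v, v \in s -> ~ mdvd u v) ->
  omega_bound u N -> (1 < N)%N.
Proof.
move=> nu sA us nus /(_ s sA us)[m [sm cm dm]]; apply: leq_trans cm.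
rewrite -(size_mask sm); case e: (mask m s) dm => [|v [|//]].
  by rewrite big_nil => /(mdvd_munit (munit1 S)) uu; rewrite uu in nu.
by rewrite big_seq1 => /nus[]; apply: (mem_mask (m := m)); rewrite e mem_head.
Qed.

(* An element of [s] is kept as soon as one of its own atoms is selected. *)
Lemma mask_flatten (s : seq S) (F : S -> seq S) m :
  (forall e, e \in s -> mdvd (\prod_(x <- F e) x) e) ->
  size m = size (flatten (map F s)) ->
  exists m', [/\ size m' = size s, (count id m' <= count id m)%N
    & mdvd (\prod_(x <- mask m (flatten (map F s))) x) (\prod_(x <- mask m' s) x)].
Proof.
elim: s m => [|e s IHs] m sF /=.
  by move=> /size0nil->; exists [::]; rewrite /= !big_nil; split=> //; apply: mdvd_refl.
rewrite size_cat => sm; set k := size (F e) in sm.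
have sk : size (take k m) = k by rewrite size_take_min sm (minn_idPl _) // leq_addr.
have [||m' [sm' cm' dm']] := IHs (drop k m).
- by move=> a as_; apply: sF; rewrite inE as_ orbT.
- by rewrite size_drop sm addKn.
exists ((0 < count id (take k m))%N :: m'); rewrite /= sm'; split=> //.
  rewrite -[X in (_ <= count id X)%N](cat_take_drop k) count_cat leq_add //.
  by case: (count _ _).
rewrite -[X in mask X](cat_take_drop k) mask_cat // big_cat /=.
case: posnP => [c0|_].
  have /size0nil-> : size (mask (take k m) (F e)) = 0%N by rewrite size_mask.
  by rewrite big_nil mul1g.
rewrite big_cons; have [c ec] := sF e (mem_head _ _).
have [f fe] := mdvd_mask (take k m) (F e); have [g ->] := dm'.
by exists (f * c * g); rewrite {1}ec fe [RHS]mulgACA -!mulgA.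
Qed.

(** Made for second components, which are arbitrary elements of [D]: they are refined into atoms,
    and the selected atoms come from at most as many elements. *)
Lemma omega_bound_any (u : S) N : atomic S -> omega_bound u N ->
  forall s, mdvd u (\prod_(x <- s) x) ->
  exists m, [/\ size m = size s, (count id m <= N)%N & mdvd u (\prod_(x <- mask m s) x)].
Proof.
move=> Sat uN s us; have [F FP] := choice Sat.
have pF : mdvd (\prod_(x <- s) x) (\prod_(x <- flatten (map F s)) x).
  elim: s {us} => [|e s IHs] /=; first exact: mdvd_refl.
  rewrite big_cons big_cat /=; have [_ /associated_dvd[c ->]] := FP e.
  by have [d ->] := IHs; exists (c * d); rewrite mulgACA.
have [||m [sm cm dm]] := uN (flatten (map F s)).
- by move=> v /flatten_mapP[e _ ve]; apply: (FP e).1.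
- exact: mdvd_trans pF.
have [|m' [sm' cm' dm']] := @mask_flatten s F m _ sm.
  by move=> e _; apply/associated_dvd/associated_sym; case: (FP e).
exists m'; split=> //; first exact: leq_trans cm.
exact: mdvd_trans dm'.
Qed.

End Masks.

(* The common shape of [H -> H_0, D] and of [H_red -> (H_0)_red, D]: the latter
   makes sense because units of [H] have second component [1]. *)
Record propto_proj (T S D : cmonoidType) (p : T -> S) (q : T -> D)
    (r : S -> D -> T) : Prop := ProptoProj {
  proj_fst_morph : monoid_morphism p;
  proj_snd_morph : monoid_morphism q;
  proj_inj : forall x y, p x = p y -> q x = q y -> x = y;
  proj_unit : forall x, p x \in munit -> q x = 1;
  proj_section : forall a d, a \notin munit \/ d = 1 ->
    p (r a d) = a /\ q (r a d) = d }.

Section ProptoProj.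
Variables (T S D : cmonoidType) (p : T -> S) (q : T -> D) (r : S -> D -> T).
Hypothesis h : propto_proj p q r.
Implicit Types (x y z : T) (a b c u : S) (d e f : D).

Lemma proj_p1 : p 1 = 1. Proof. by case: (proj_fst_morph h). Qed.
Lemma proj_pM x y : p (x * y) = p x * p y.
Proof. by case: (proj_fst_morph h) => ? ->. Qed.
Lemma proj_q1 : q 1 = 1. Proof. by case: (proj_snd_morph h). Qed.
Lemma proj_qM x y : q (x * y) = q x * q y.
Proof. by case: (proj_snd_morph h) => ? ->. Qed.

Lemma proj_p_prod (s : seq T) : p (\prod_(x <- s) x) = \prod_(x <- map p s) x.
Proof. by rewrite big_map; apply: (big_morph _ proj_pM proj_p1). Qed.
Lemma proj_q_prod (s : seq T) : q (\prod_(x <- s) x) = \prod_(x <- map q s) x.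
Proof. by rewrite big_map; apply: (big_morph _ proj_qM proj_q1). Qed.

Lemma proj_rp a d : a \notin munit -> p (r a d) = a.
Proof. by move=> na; case: (proj_section h (or_introl na) (d := d)). Qed.
Lemma proj_rq a d : a \notin munit -> q (r a d) = d.
Proof. by move=> na; case: (proj_section h (or_introl na) (d := d)). Qed.
Lemma proj_rp1 a : p (r a 1) = a.
Proof. by case: (proj_section h (a := a) (or_intror (erefl 1))). Qed.
Lemma proj_rq1 a : q (r a 1) = 1.
Proof. by case: (proj_section h (a := a) (or_intror (erefl 1))). Qed.

Lemma proj_rK x : r (p x) (q x) = x.
Proof.
have [rp rq] : p (r (p x) (q x)) = p x /\ q (r (p x) (q x)) = q x.
  by apply: (proj_section h); case: (boolP (p x \in munit)) => [/(proj_unit h)|]; [right|left].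
exact: (proj_inj h).
Qed.

Lemma munit_p x : (p x \in munit) = (x \in munit).
Proof.
apply/idP/idP => [ux|/munitP[y xy]]; last first.
  by apply/munitP; exists (p y); rewrite -proj_pM xy proj_p1.
have /munitP[b xb] := ux; apply/munitP; exists (r b 1).
apply: (proj_inj h); first by rewrite proj_pM proj_rp1 xb proj_p1.
by rewrite proj_qM (proj_unit h ux) proj_rq1 mulg1 proj_q1.
Qed.

Lemma mdvd_p x y : mdvd x y -> mdvd (p x) (p y).
Proof. by move=> [z ->]; exists (p z); rewrite proj_pM. Qed.
Lemma mdvd_q x y : mdvd x y -> mdvd (q x) (q y).
Proof. by move=> [z ->]; exists (q z); rewrite proj_qM. Qed.

Lemma mdvd_lift x y c f : p y = p x * c -> q y = q x * f ->
  c \notin munit \/ f = 1 -> mdvd x y.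
Proof.
move=> pe qe cf; have [rp rq] := proj_section h cf.
by exists (r c f); apply: (proj_inj h); rewrite (proj_pM, proj_qM) (rp, rq).
Qed.

(** The whole second component of [x] goes to a factor with non-unit first component; if both [b]
    and [c] are units, it is 1. *)
Lemma proj_split x b c : p x = b * c -> exists y z, [/\ x = y * z, p y = b & p z = c].
Proof.
move=> xbc; have [ub|nb] := boolP (b \in munit).
  have [rp rq] : p (r c (q x)) = c /\ q (r c (q x)) = q x.
    apply: (proj_section h); case: (boolP (c \in munit)) => uc; [right|by left].
    by apply: (proj_unit h); rewrite xbc munitM ub.
  exists (r b 1), (r c (q x)); rewrite proj_rp1 rp; split=> //.
  by apply: (proj_inj h); rewrite (proj_pM, proj_qM) (proj_rp1, proj_rq1) (rp, rq) ?mul1g.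
exists (r b (q x)), (r c 1); rewrite proj_rp1 proj_rp //; split=> //.
apply: (proj_inj h); first by rewrite proj_pM proj_rp1 proj_rp.
by rewrite proj_qM proj_rq1 mulg1 proj_rq.
Qed.

(** Splittings of [p x] lift by [proj_split], and [p] preserves and reflects units: the atoms of [H]
    are the pairs with an atom in first place, whatever the second. *)
Lemma atom_p x : atom (p x) <-> atom x.
Proof.
rewrite /atom munit_p; split=> -[nx xP]; split=> //.
  by move=> y z e; have := xP (p y) (p z); rewrite !munit_p e proj_pM; apply.
move=> b c /proj_split[y [z [e <- <-]]]; rewrite !munit_p; exact: xP.
Qed.

Lemma atom_r u d : atom u -> atom (r u d).
Proof. by move=> Au; apply/atom_p; rewrite proj_rp //; case: Au. Qed.

Lemma atoms_p (s : seq T) : atoms s -> atoms (map p s).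
Proof. by move=> sA _ /mapP[x /sA xA ->]; apply/atom_p. Qed.

(** All of [d] sits on the first factor. The empty sequence cannot carry a [d], hence the side
    condition in [lift_q]. *)
Definition lift_seq (s : seq S) d : seq T :=
  if s is a :: s' then r a d :: map (r^~ 1) s' else [::].

Lemma lift_p (s : seq S) d : atoms s -> map p (lift_seq s d) = s.
Proof.
case: s => //= a s sA; rewrite proj_rp; last by case: (sA a (mem_head _ _)).
by rewrite -map_comp map_id_in // => b _; rewrite /= proj_rp1.
Qed.

Lemma prod_q_r1 (s : seq S) : q (\prod_(x <- map (r^~ 1) s) x) = 1.
Proof. by rewrite proj_q_prod !big_map big1 // => a _; rewrite proj_rq1. Qed.

Lemma lift_q (s : seq S) d : atoms s -> s <> [::] \/ d = 1 ->
  q (\prod_(x <- lift_seq s d) x) = d.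
Proof.
case: s => [_ [//|->]|a s sA _]; first by rewrite big_nil proj_q1.
rewrite big_cons proj_qM prod_q_r1 mulg1 proj_rq //.
by case: (sA a (mem_head _ _)).
Qed.

Lemma atoms_lift (s : seq S) d : atoms s -> atoms (lift_seq s d).
Proof. by move=> sA x xs; apply/atom_p/sA; rewrite -(lift_p d sA) map_f. Qed.

(** Lifting the sequence with second component exactly [q x] makes the second quotient 1, so
    divisibility lifts whatever [c] is. *)
Lemma omega_bound_p x N : x \notin munit -> omega_bound x N -> omega_bound (p x) N.
Proof.
move=> nx xN s sA /[dup] xs [c sE].
have s0 : s <> [::].
  move=> s0; move: xs; rewrite s0 big_nil => /(mdvd_munit (munit1 S)).
  by rewrite munit_p (negPf nx).
have [|m [sm cm dm]] := xN (lift_seq s (q x)) (atoms_lift sA).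
  apply: (@mdvd_lift _ _ c 1); [by rewrite proj_p_prod lift_p | | by right].
  by rewrite lift_q ?mulg1 //; left.
exists m; rewrite -(size_map p) lift_p // in sm; split=> //.
by rewrite -(lift_p (q x) sA) -map_mask -proj_p_prod; apply: mdvd_p.
Qed.

(** Each entry of a product in [D] is paired with the atom [p x], which produces atoms of [H] with
    prescribed second components. *)
Lemma omega_bound_q x N : atom x -> omega_bound x N -> omega_bound (q x) N.
Proof.
move=> xA xN s _ xs.
have [/atom_p uA [nx _]] := (xA, xA); set u := p x in uA; have [nu _] := uA.
have N1 : (0 < N)%N.
  apply: (omega_bound_ge1 (s := [:: x]) nx _ _ xN).
    by move=> v; rewrite inE => /eqP->.
  by rewrite big_seq1; apply: mdvd_refl.
(* At most one entry leaves no non-unit quotient in the first component, so these lengths are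
   settled by selecting everything, within [1 <= N]. *)
case: s xs => [|a [|b s]] xs; first by exists [::].
  by exists [:: true].
set t := map (r u) [:: a, b & s].
have tq : map q t = [:: a, b & s].
  by rewrite -map_comp map_id_in // => e _; rewrite /= proj_rq.
have [c cE] := xs.
have [||m [sm cm dm]] := xN t.
- by move=> _ /mapP[e _ ->]; apply: atom_r.
(* One copy of [u] is used up; the remaining ones, at least one, form the non-unit quotient. *)
- apply: (@mdvd_lift _ _ (u * \prod_(e <- s) u) c).
  + by rewrite proj_p_prod /t /= !big_cons -map_comp big_map !proj_rp //; congr (_ * (_ * _));
      apply: eq_bigr => e _; rewrite /= proj_rp.
  + by rewrite proj_q_prod tq.
  + by left; rewrite munitM negb_and nu.
exists m; rewrite -(size_map q) tq in sm; split=> //.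
by rewrite -tq -map_mask -proj_q_prod; apply: mdvd_q.
Qed.

(* [2 <= N] leaves room for one more factor when the selected subproduct is
   associated to [p x]. *)
Lemma omega_bound_lift x n1 n2 N : atomic D -> atom x -> omega_bound (p x) n1 ->
  omega_bound (q x) n2 -> (n1 + n2 <= N)%N -> (2 <= N)%N -> omega_bound x N.
Proof.
move=> Dat xA b1 b2 n12 N2 s sA xs; have /atom_p pxA := xA.
have [|m1 [sm1 cm1 d1]] := b1 (map p s) (atoms_p sA).
  by rewrite -proj_p_prod; apply: mdvd_p.
have [|m2 [sm2 cm2 d2]] := omega_bound_any Dat b2 (s := map q s).
  by rewrite -proj_q_prod; apply: mdvd_q.
rewrite size_map in sm1; rewrite size_map in sm2.
have [m [sm cm e1 e2]] := mask_or sm1 sm2.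
have [c cE] : mdvd (p x) (p (\prod_(y <- mask m s) y)).
  by apply: mdvd_trans (mdvd_p e1); rewrite proj_p_prod map_mask.
have [f fE] : mdvd (q x) (q (\prod_(y <- mask m s) y)).
  by apply: mdvd_trans (mdvd_q e2); rewrite proj_q_prod map_mask.
have mN : (count id m <= N)%N.
  by apply: leq_trans n12; apply: leq_trans cm _; apply: leq_add.
have [uc|nc] := boolP (c \in munit); last first.
  by exists m; split=> //; apply: mdvd_lift cE fE _; left.
(* With a unit quotient the selected product is associated to the atom [p x], so a single factor was
   selected and one more stays within [2 <= N]. *)
have cm1' : count id m = 1%N.
  rewrite -(size_mask sm) -(size_map p).
  have [||v -> //] := atom_eq_prod pxA (s := map p (mask m s)) _ uc.
    by apply: atoms_p => v vm; apply: sA; apply: mem_mask vm.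
  by rewrite -proj_p_prod.
have [ms|] := ltnP (count id m) (size s).
  have [m' [z [sm' cm' zs zE]]] := mask_add1 sm ms.
  exists m'; rewrite cm' cm1'; split=> //; rewrite zE cmulgC.
  apply: (@mdvd_lift _ _ (c * p z) (f * q z)).
  - by rewrite proj_pM cE mulgA.
  - by rewrite proj_qM fE mulgA.
  left; rewrite munitM negb_and munit_p; apply/orP; right.
  by case: (sA z zs).
rewrite -sm => mt; exists m; split=> //.
suff /all_pred1P-> : all (pred1 true) m by rewrite mask_true ?sm.
rewrite (eq_all (a2 := id)); last by case.
by rewrite all_count eqn_leq count_size mt.
Qed.

End ProptoProj.

(** * Tau and tame degrees *)

Lemma perm_map_lift (A B : eqType) (f : A -> B) (s : seq A) (t : seq B) :
  perm_eq (map f s) t -> exists2 s', perm_eq s s' & map f s' = t.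
Proof.
elim: t s => [|b t IHt] s pst.
  by exists [::] => //; case: s pst => // a s /perm_size.
have /mapP[a as_ ba] : b \in map f s by rewrite (perm_mem pst) mem_head.
have pas := perm_to_rem as_.
have /IHt[s' ps' <-] : perm_eq (map f (rem a s)) t.
  by rewrite -(perm_cons b) -(permPr pst) ba -map_cons perm_map // perm_sym.
by exists (a :: s'); rewrite ?(permPl pas) ?perm_cons // ba.
Qed.

Section TauTame.
Variable S : cmonoidType.
Implicit Types (c u v : S) (s t : seq S).

Lemma lengths_atom u : atom u -> lengths u 1.
Proof.
move=> uA; apply/lengthsP; exists [:: u]; rewrite big_seq1; split=> //.
  by move=> v; rewrite inE => /eqP->.
exact: associated_refl.
Qed.

Lemma min_length_ge1 c : c \notin munit -> enat_le (Fin 1) (enat_min (lengths c)).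
Proof.
move=> nc; apply: enat_le_min => -[|n //] /lengthsP[s [_ /size0nil-> ]].
by rewrite big_nil => /associated_munit; rewrite munit1 (negPf nc).
Qed.

(* Take a product of atoms with the fewest factors that [u] divides without
   dividing any factor. *)
Lemma tau_ge1_nonprime u :
  atomic S -> atom u -> ~ mprime u -> enat_le (Fin 1) (tau u).
Proof.
move=> Sat uA npu; have [s0 [s0A us0 nus0]] := nonprime_dvd_prod Sat uA npu.
pose P k := exists v : 'I_k -> S, [/\ forall i, atom (v i),
  mdvd u (\prod_(i < k) v i) & forall i, ~ mdvd u (v i)].
have exP : exists k, `[< P k >].
  exists (size s0); apply/asboolP; exists (tnth (in_tuple s0)); split.
  - by move=> i; apply/s0A/mem_tnth.
  - by rewrite -(big_tnth _ _ _ xpredT id).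
  - by move=> i; apply/nus0/mem_tnth.
case: (ex_minnP exP) => k /asboolP[v [vA uv nuv]] kmin.
case: k => [|k] in v vA uv nuv kmin *.
  case: uA => /negP[]; move: uv; rewrite big_ord0; exact: mdvd_munit (munit1 S).
have [c cE] := uv.
apply: (@enat_le_trans (enat_min (lengths c))).
  apply: min_length_ge1; apply/negP => /munitP[c' cc'].
  have [nv0 _] := vA ord0; apply: (nuv ord0); apply/associated_dvd/associated_sym.
  apply: atom_dvd_assoc => //; exists (\prod_(i < k) v (lift ord0 i) * c').
  by rewrite mulgA -big_ord_recl cE -mulgA cc' mulg1.
apply: enat_le_sup; exists c, k.+1, v; split=> // i ui.
(* Dropping [v i] while keeping [u] as a divisor would contradict the minimal number of factors. *)
suff /kmin : `[< P k >] by rewrite ltnn.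
apply/asboolP; exists (v \o lift i); split=> [j|| j].
- exact: vA.
- suff <- : \prod_(j < k.+1 | j != i) v j = \prod_(j < k) v (lift i j) by [].
  apply: (@cmulgI _ (v i)); rewrite -[RHS]/(v i * \prod_(j < k.+1.-1) v (lift i j)).
  by rewrite -(bigD1_ord i (P := xpredT)) // [RHS](bigD1 i).
- exact: nuv.
Qed.

(** [u] divides some [v i], and the deletion condition then excludes all other factors. Hence [v i]
    is associated to [u] and the quotient is a unit, of length 0. *)
Lemma tau_prime_le1 u : mprime u -> enat_le (tau u) (Fin 1).
Proof.
move=> up; apply/enat_sup_le => _ [c [k [v [vA vE uv ->]]]].
have [i ui] : exists i, mdvd u (v i).
  have [|x] := prime_dvd_prod up (s := map v (enum 'I_k)).
    by rewrite big_map big_enum vE; apply/mdvd_mulr/mdvd_refl.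
  by move=> /mapP[i _ ->] ux; exists i.
have vi : \prod_(j < k | j != i) v j = 1.
  apply: big1 => j ji; case: (uv j); rewrite (bigD1 i) 1?eq_sym //.
  exact: mdvd_mulr.
have /(atom_dvd_assoc up.1 (vA i)) [e ue vE'] := ui.
apply: enat_le_trans (enat_0le _); apply: enat_min_le; apply/lengthsP.
exists [::]; split=> //; rewrite big_nil.
apply/associated_sym; exists c; rewrite ?mul1g //.
by move: vE; rewrite (bigD1 i) //= vi mulg1 vE' => /cmulgI <-.
Qed.

Lemma tame_bound_ge2 u s N : u \notin munit -> atoms s ->
  mdvd u (\prod_(x <- s) x) -> (forall v, v \in s -> ~ mdvd u v) ->
  tame_bound u N -> (1 < N)%N.
Proof.
move=> nu sA us nus /(_ s sA us) [|t [t' [w [pt _ tE _ st]]]].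
  by apply/negP => /nus; apply; apply: mdvd_refl.
apply: leq_trans st; have ut : mdvd u (\prod_(x <- t) x) by rewrite tE; apply/mdvd_mulr/mdvd_refl.
case: t => [|v [|//]] in pt ut {tE} *.
  by move: ut; rewrite big_nil => /(mdvd_munit (munit1 S)) uu; rewrite uu in nu.
by move: ut; rewrite big_seq1 => /nus[]; rewrite (perm_mem pt) mem_head.
Qed.

(** Holds vacuously: in a reduced monoid a prime dividing a product of atoms is one of these
    atoms. *)
Lemma tame_bound_prime u : reduced S -> mprime u -> tame_bound u 0.
Proof.
move=> Sred up s sA /(prime_dvd_prod up)[v vs uv] /negP[].
have [e /Sred e1 vE] := atom_dvd_assoc up.1 (sA v vs) uv.
by rewrite -(mulg1 u) -[X in u * X]e1 -vE.
Qed.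

Lemma omega_ge1 u n : atomic S -> u \notin munit ->
  omega_bound u n -> (0 < n)%N.
Proof.
move=> Sat nu; have [s sA uE] := atomic_prod Sat nu.
by apply: (omega_bound_ge1 nu sA); rewrite -uE; apply: mdvd_refl.
Qed.

Lemma omega_ge2_nonprime u n : atomic S -> atom u ->
  ~ mprime u -> omega_bound u n -> (1 < n)%N.
Proof.
move=> Sat uA npu; have [s [sA us nus]] := nonprime_dvd_prod Sat uA npu.
exact: (omega_bound_ge2 uA.1 sA us nus).
Qed.

(** Tested on [n] copies of [v], of which all are needed. *)
Lemma omega_bound_expg v n N : atom v -> omega_bound (v ^+ n) N -> (n <= N)%N.
Proof.
move=> vA; have [nv _] := vA; case/(_ (nseq n v)).
- by move=> x /nseqP[->].
- by rewrite (prod_map_expg (all_pred1_nseq _ _)) size_nseq; apply: mdvd_refl.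
move=> m [sm cm dm]; apply: leq_trans cm; rewrite -(size_mask sm).
apply: (expg_dvd_leq nv); rewrite -prod_map_expg //.
by apply/allP => x /mem_mask /nseqP[->] /=.
Qed.

End TauTame.

Section ProptoProjTau.
Variables (T S D : cmonoidType) (p : T -> S) (q : T -> D) (r : S -> D -> T).
Hypothesis h : propto_proj p q r.
Implicit Types (x y z : T) (a b c u : S) (d e f : D).

Lemma lengths_p x n : lengths (p x) n <-> lengths x n.
Proof.
split=> /lengthsP[s [sA <- sE]]; apply/lengthsP; last first.
  exists (map p s); rewrite size_map; split=> //; first exact: (atoms_p h).
  have [e ue eE] := sE; exists (p e); first by rewrite (munit_p h).
  by rewrite -(proj_p_prod h) eE (proj_pM h).
exists (lift_seq r s (q x)); rewrite -(size_map p) (lift_p h) //; split=> //.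
  exact: (atoms_lift h).
have [e ue eE] := sE; exists (r e 1); first by rewrite -(munit_p h) (proj_rp1 h).
apply: (proj_inj h).
  by rewrite (proj_p_prod h) (lift_p h) // (proj_pM h) (proj_rp1 h).
rewrite (proj_qM h) (proj_rq1 h) mulg1 (lift_q h) //.
have [s0|s0] := eqVneq s [::]; [right|by left; apply/eqP].
by apply: (proj_unit h); rewrite (associated_munit sE) s0 big_nil munit1.
Qed.

Lemma min_length_p x : enat_min (lengths (p x)) = enat_min (lengths x).
Proof. by apply: eq_enat_min => n; apply: lengths_p. Qed.

(** The atoms are lifted with [q x] on the one of index 0 and 1 elsewhere, the quotient with second
    component 1. Non-divisibility lifts because [p] preserves divisibility. *)
Lemma tau_p x : x \notin munit -> enat_le (tau (p x)) (tau x).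
Proof.
move=> nx; apply/enat_sup_le => _ [c [[|k] [u [uA uE nu ->]]]].
  have : p x * c \in munit by rewrite -uE big_ord0 munit1.
  by rewrite munitM (munit_p h) (negPf nx).
rewrite -[c in lengths c](proj_rp1 h) min_length_p.
pose u' i := r (u i) (if i == ord0 then q x else 1).
have pu' i : p (u' i) = u i by rewrite (proj_rp h) //; case: (uA i).
apply: enat_le_sup; exists (r c 1), k.+1, u'; split=> //.
- by move=> i; apply/(atom_p h); rewrite pu'.
- apply: (proj_inj h).
    rewrite (big_morph _ (proj_pM h) (proj_p1 h)) (eq_bigr u) => [|i _] //.
    by rewrite (proj_pM h) (proj_rp1 h).
  rewrite (big_morph _ (proj_qM h) (proj_q1 h)) (proj_qM h) (proj_rq1 h) mulg1.
  rewrite (eq_bigr (fun i => if i == ord0 then q x else 1)) => [|i _].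
    by rewrite -big_mkcond big_pred1_eq.
  by rewrite (proj_rq h) //; case: (uA i).
move=> i /(mdvd_p h); rewrite (big_morph _ (proj_pM h) (proj_p1 h)).
by rewrite (eq_bigr u) //; apply: nu.
Qed.

Lemma tame_bound_p x N : x \notin munit -> tame_bound x N -> tame_bound (p x) N.
Proof.
move=> nx xN s sA /[dup] xs [c sE] pxs.
have s0 : s <> [::].
  move=> s0; move: xs; rewrite s0 big_nil => /(mdvd_munit (munit1 S)).
  by rewrite (munit_p h) (negPf nx).
have [||t [t' [w [pt wA tE sw st]]]] := xN (lift_seq r s (q x)) (atoms_lift h sA).
- apply: (@mdvd_lift _ _ _ _ _ _ h _ _ c 1); [by rewrite (proj_p_prod h) (lift_p h) | | by right].
  by rewrite (lift_q h) ?mulg1 //; left.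
- by apply: contra pxs => xs'; rewrite -(lift_p h (q x) sA) map_f.
exists (map p t), (map p t'), (map p w); rewrite !size_map; split=> //.
- by rewrite -(lift_p h (q x) sA) -map_cat perm_map.
- exact: (atoms_p h).
by rewrite -!(proj_p_prod h) tE (proj_pM h).
Qed.

(** The quotient has first component 1, a unit, and so its second component is 1 too. *)
Lemma mdvd_same_p x y : p y = p x -> mdvd x y -> y = x.
Proof.
move=> pyx [z yE]; suff z1 : z = 1 by rewrite yE z1 mulg1.
have pz : p z = 1.
  by apply: (@cmulgI _ (p x)); rewrite mulg1 -(proj_pM h) -yE.
apply: (proj_inj h); rewrite ?(proj_p1 h) // (proj_q1 h).
by apply: (proj_unit h); rewrite pz munit1.
Qed.

(** The test sequence is [n] copies of [(p x, v)], whose second components multiply to [q x]. A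
    subproduct divisible by [x] needs all [n] factors [v], and [v <> v ^+ n] keeps [x] itself out of
    the sequence. *)
Lemma tame_bound_expg x v n N : atom x -> atom v -> q x = v ^+ n -> v <> v ^+ n ->
  tame_bound x N -> (n <= N)%N.
Proof.
move=> xA vA qx nvn xN; have [n0|n_gt0] := posnP n; first by rewrite n0.
have uA : atom (p x) by apply/(atom_p h).
have [[nu _] [nv _]] := (uA, vA); set y := r (p x) v.
have [py qy] : p y = p x /\ q y = v by rewrite /y (proj_rp h) // (proj_rq h).
have [|||t [t' [w [pt wA tE sw st]]]] := xN (nseq n y).
- by move=> z /nseqP[-> _]; apply/(atom_p h); rewrite py.
- have p_nseq : p (\prod_(z <- nseq n y) z) = p x * p x ^+ n.-1.
    rewrite (proj_p_prod h) map_nseq py (prod_map_expg (all_pred1_nseq _ _)).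
    by rewrite size_nseq -expgS prednK.
  apply: (mdvd_lift h p_nseq (f := 1)); last by right.
  by rewrite (proj_q_prod h) map_nseq qy (prod_map_expg (all_pred1_nseq _ _)) size_nseq qx mulg1.
- by rewrite mem_nseq n_gt0; apply/eqP => xy; apply: nvn; rewrite -qx xy qy.
apply: leq_trans st; rewrite -(size_map q); apply: (expg_dvd_leq nv).
rewrite -qx -prod_map_expg; last first.
  apply/allP => _ /mapP[z zt ->]; apply/eqP.
  suff /nseqP[-> _] : z \in nseq n y by [].
  by rewrite (perm_mem pt) mem_cat zt.
by rewrite -(proj_q_prod h) tE (proj_qM h); apply/mdvd_mulr/mdvd_refl.
Qed.

Section GroupD.
Hypothesis Dgrp : is_group D.

Lemma tau_lift_le x : atom x -> enat_le (tau x) (enat_max (Fin 1) (tau (p x))).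
Proof.
move=> xA; have [npx _] : atom (p x) by apply/(atom_p h).
apply/enat_sup_le => _ [c [k [u [uA uE nu ->]]]].
have pE : \prod_(i < k) p (u i) = p x * p c.
  by rewrite -(big_morph _ (proj_pM h) (proj_p1 h)) uE (proj_pM h).
have [hu|/existsNP[i /contrapT]] :=
  pselect (forall i, ~ mdvd (p x) (\prod_(j < k | j != i) p (u j))).
  apply: enat_le_trans (enat_le_maxr _ _).
  rewrite -min_length_p; apply: enat_le_sup; exists (p c), k, (p \o u); split=> //.
  by move=> i; apply/(atom_p h).
rewrite -(big_morph _ (proj_pM h) (proj_p1 h)) => -[e eE].
apply: enat_le_trans (enat_le_maxl _ _); apply: enat_min_le.
(* Divisibility in the group [D] is automatic, so a non-unit [e] would make [x] divide the rest as
   well. *)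
have ue : e \in munit.
  apply: contrapT => /negP ne; apply: (nu i).
  have [f fE] := munit_mdvd (q (\prod_(j < k | j != i) u j)) (Dgrp (q x)).
  by apply: (mdvd_lift h eE fE); left.
apply: lengths_atom; apply/(atom_p h).
suff -> : p c = p (u i) * e by apply: atomMunit => //; apply/(atom_p h).
apply: (@cmulgI _ (p x)); rewrite -pE (bigD1 i) //=.
by rewrite -(big_morph _ (proj_pM h) (proj_p1 h)) eE mulgA (cmulgC _ (p x)) mulgA.
Qed.

(** Take [y] with the first component of [x] and a different second one: the square leaves the
    non-unit quotient [p x], a single [y] leaves 1. *)
Lemma square_multiple x : atom x -> ~ (forall d, d = 1) ->
  exists y, [/\ atom y, mdvd x (y * y) & ~ mdvd x y].
Proof.
move=> xA nD; have [npx _] : atom (p x) by apply/(atom_p h).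
have [e ne] : exists e, e <> q x.
  have /existsNP[e ne1] := nD; have [qx|nqx] := pselect (q x = 1).
    by exists e; rewrite qx.
  by exists 1 => qx; apply: nqx.
have [py qy] : p (r (p x) e) = p x /\ q (r (p x) e) = e.
  by rewrite (proj_rp h) // (proj_rq h).
exists (r (p x) e); split; first by apply/(atom_p h); rewrite py; apply/(atom_p h).
  have [f fE] := munit_mdvd (q (r (p x) e * r (p x) e)) (Dgrp (q x)).
  by apply: (@mdvd_lift _ _ _ _ _ _ h _ _ (p x) f) => //; [rewrite (proj_pM h) py | left].
by move=> /(mdvd_same_p py) xy; apply: ne; rewrite -xy qy.
Qed.

Lemma tau_ge1 x : atom x -> ~ (forall d, d = 1) -> enat_le (Fin 1) (tau x).
Proof.
move=> xA nD; have [y [yA [c cE] nxy]] := square_multiple xA nD.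
apply: (@enat_le_trans (enat_min (lengths c))).
  apply: min_length_ge1; apply/negP => uc; apply: nxy.
  have [||] := @atom_eq_prod _ x [:: y; y] c xA _ uc.
  - by move=> v; rewrite !inE orbb => /eqP->.
  - by rewrite big_cons big_seq1.
  - by [].
apply: enat_le_sup; exists c, 2%N, (fun=> y); split=> //.
  by rewrite big_ord_recl big_ord1.
by move=> i; rewrite (prodg_const (predC1 i)) cardC1 card_ord.
Qed.

(** If a factor has first component [p x], it and any other factor are rewritten as [x] times an
    atom, at cost 2. Otherwise the bound for [p x] applies, and the second components are balanced
    in the group [D]. *)
Lemma tame_bound_lift x N : atom x -> tame_bound (p x) N -> tame_bound x (maxn 2 N).
Proof.
move=> xA pxN s sA xs nxs.
have pxA : atom (p x) by apply/(atom_p h).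
have [npx _] := pxA.
have [/mapP[y ys pxy]|nps] := boolP (p x \in map p s).
  (* A lone factor with first component [p x] that is a multiple of [x] would be [x] itself, which
     [s] does not contain. *)
  have pss := perm_to_rem ys; case e: (rem y s) => [|z s'] in pss.
    case/negP: nxs; rewrite (perm_mem pss) inE; apply/eqP/esym/mdvd_same_p => //.
    by move: xs; rewrite (perm_big _ pss) big_seq1.
  have [zs nyA] : z \in s /\ p y \notin munit.
    by rewrite (perm_mem pss) !inE eqxx orbT -pxy.
  have [nz _] : atom (p z) by apply/(atom_p h)/sA.
  have [f fE] := munit_mdvd (q (y * z)) (Dgrp (q x)).
  exists [:: y; z], s', [:: r (p z) f]; split=> //.
  - by move=> v; rewrite inE => /eqP->; apply: (atom_r h); apply/(atom_p h)/sA.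
  - rewrite big_cons !big_seq1; apply: (proj_inj h).
      by rewrite !(proj_pM h) (proj_rp h) // pxy.
    by rewrite [RHS](proj_qM h) (proj_rq h).
  - by rewrite leq_max.
  - by rewrite leq_max.
have [|t1 [t2 [w [pt wA tE sw st]]]] := pxN _ (atoms_p h sA) _ nps.
  by rewrite -(proj_p_prod h); apply: (mdvd_p h xs).
have [st' pst tt] := perm_map_lift pt.
have t1E : map p (take (size t1) st') = t1 by rewrite map_take tt take_size_cat.
set t := take (size t1) st' in t1E; pose t' := drop (size t1) st'.
have tA : atoms t.
  by move=> v vt; apply: sA; rewrite (perm_mem pst) -(cat_take_drop (size t1) st') mem_cat vt.
(* Some atom must carry the balancing component [f]; an empty [w] would put [p x] among the
   images. *)
have w0 : w <> [::].
  move=> w0; rewrite w0 big_nil -t1E in tE.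
  have [v vE v1] := atom_eq_prod pxA (atoms_p h tA) (munit1 S) tE.
  case/negP: nps; rewrite -(mulg1 (p x)) -v1 (perm_mem pt) mem_cat -t1E vE.
  by rewrite mem_head.
have [f fE] := munit_mdvd (q (\prod_(y <- t) y)) (Dgrp (q x)).
exists t, t', (lift_seq r w f); rewrite cat_take_drop; split=> //.
- exact: (atoms_lift h).
- apply: (proj_inj h).
    by rewrite (proj_p_prod h) t1E tE (proj_pM h) (proj_p_prod h) (lift_p h).
  by rewrite (proj_qM h) (lift_q h) //; left.
- by rewrite -(size_map p) (lift_p h) // leq_max sw orbT.
by rewrite -(size_map p) t1E leq_max st orbT.
Qed.

End GroupD.
End ProptoProjTau.

(** * Catenary degrees *)

Section Chains.
Variable S : cmonoidType.
Implicit Types (x : S) (s t g a b : seq S).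

Definition uniq_fac x := forall s t, fac x s -> fac x t -> perm_eq s t.

Lemma fac_step_sym N s t : fac_step N s t -> fac_step N t s.
Proof. by move=> [g [a [b [? ? ? ?]]]]; exists g, b, a. Qed.

Lemma fac_chain_fac N x s t : fac x s -> fac_chain N x s t -> fac x t.
Proof. by move=> + st; elim: st => {s t}[s t [] | s | s t u _ IH1 _ IH2 /IH1]. Qed.

Lemma fac_chain_sym N x s t : fac x s -> fac_chain N x s t -> fac_chain N x t s.
Proof.
move=> + st; elim: st => {s t}[s t [xt st] xs | s _ | s t u st IH1 tu IH2 xs].
- by apply: fac_chain_step => //; apply: fac_step_sym.
- exact: rt_refl.
- by apply: fac_chain_trans (IH2 (fac_chain_fac xs st)) (IH1 xs).
Qed.

Lemma fac_chain_le M N x s t : (M <= N)%N -> fac_chain M x s t -> fac_chain N x s t.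
Proof.
move=> MN; elim=> {s t}[s t [xt [g [a [b [pa pb sa sb]]]]] | s | s t u _ st _ tu].
- apply: fac_chain_step => //; exists g, a, b.
  by split=> //; [apply: leq_trans sa _ | apply: leq_trans sb _].
- exact: rt_refl.
- exact: fac_chain_trans tu.
Qed.

Lemma fac_cancel x g a b : fac x (g ++ a) -> fac x (g ++ b) ->
  \prod_(y <- a) y = \prod_(y <- b) y.
Proof. by rewrite /fac !big_cat => -[_ <-] [_ /cmulgI]. Qed.

Lemma fac_nil_eq x g b : fac x (g ++ [::]) -> fac x (g ++ b) -> b = [::].
Proof.
move=> xg xb; have /esym := fac_cancel xg xb; rewrite big_nil => b1.
apply: prod_atoms_munit; last by rewrite b1 munit1.
by move=> v vb; apply: xb.1; rewrite mem_cat vb orbT.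
Qed.

(** After cancelling [g] at most one atom remains on each side, with equal products. *)
Lemma fac_step1 x s t : fac x s -> fac x t -> fac_step 1 s t -> perm_eq s t.
Proof.
move=> xs xt [g [a [b [pa pb sa sb]]]].
have [xga xgb] := (fac_perm pa xs, fac_perm pb xt).
rewrite (permPl pa) (permPr pb) perm_cat2l.
case: a b sa sb {pa pb} xga xgb => [|y []] // [|z []] // _ _ xga xgb.
- by rewrite (fac_nil_eq xga xgb).
- by rewrite (fac_nil_eq xgb xga).
by have := fac_cancel xga xgb; rewrite !big_seq1 => ->.
Qed.

Lemma fac_chain1 x s t : fac x s -> fac_chain 1 x s t -> perm_eq s t.
Proof.
move=> + st; elim: st => {s t}[s t [xt st] xs | s // | s t u st IH1 _ IH2 xs].
  exact: fac_step1 xs xt st.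
by apply: perm_trans (IH1 xs) (IH2 _); apply: fac_chain_fac st.
Qed.

End Chains.

Section CatenaryUnique.
Variables (S : cmonoidType) (a : S).

Lemma cat_deg_uniq : uniq_fac (cls a) -> cat_deg a = Fin 0.
Proof.
move=> ua; apply: enat_le_anti (enat_0le _); apply/cat_leP => s t xs xt.
by apply: fac_chain_perm => //; apply: ua.
Qed.

Lemma cat_deg_ge2 : ~ uniq_fac (cls a) -> enat_le (Fin 2) (cat_deg a).
Proof.
move=> nua; apply: enat_le_ext => N /cat_leP aN /=; rewrite ltnNge.
apply/negP => N1; apply: nua => s t xs xt; apply: fac_chain1 (xs) _.
exact: fac_chain_le (aN s t xs xt).
Qed.

Lemma cat_deg0_uniq : cat_deg a = Fin 0 -> uniq_fac (cls a).
Proof. by move=> a0; apply: contrapT => /cat_deg_ge2; rewrite a0. Qed.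

End CatenaryUnique.

Section ProptoProjCat.
Variables (T S D : cmonoidType) (p : T -> S) (q : T -> D) (r : S -> D -> T).
Hypothesis h : propto_proj p q r.
Implicit Types (x y w : T) (z : seq T) (s t : seq S) (U V : S) (d e f : D).

Lemma fac_p x z : fac x z -> fac (p x) (map p z).
Proof. by move=> [zA <-]; split; [apply: (atoms_p h) | rewrite (proj_p_prod h)]. Qed.

Lemma fac_lift x s : fac (p x) s -> fac x (lift_seq r s (q x)).
Proof.
move=> [sA sE]; split; first exact: (atoms_lift h).
apply: (proj_inj h); first by rewrite (proj_p_prod h) (lift_p h).
rewrite (lift_q h) //; have [s0|s0] := eqVneq s [::]; [right|by left; apply/eqP].
by apply: (proj_unit h); rewrite -sE s0 big_nil munit1.
Qed.

Lemma fac_chain_p N x z z' :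
  fac_chain N x z z' -> fac_chain N (p x) (map p z) (map p z').
Proof.
elim=> {z z'}[z z' [xz' [g [a [b [pa pb sa sb]]]]] | z | z z' z'' _ IH1 _ IH2].
- apply: fac_chain_step; first exact: fac_p.
  by exists (map p g), (map p a), (map p b); rewrite !size_map -!map_cat !perm_map.
- exact: rt_refl.
- exact: fac_chain_trans IH2.
Qed.

Lemma uniq_fac_p x : uniq_fac x -> uniq_fac (p x).
Proof.
move=> ux s t xs xt; rewrite -(lift_p h (q x) xs.1) -(lift_p h (q x) xt.1).
by apply/perm_map/ux; apply: fac_lift.
Qed.

(* The second components are collected in the first factor, one factor at a time. *)
Lemma fac_chain_collect x y z1 z2 : fac x (y :: z1 ++ z2) ->
  fac_chain 2 x (y :: z1 ++ z2)
    (r (p y) (q y * q (\prod_(w <- z2) w)) :: z1 ++ map (r^~ 1) (map p z2)).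
Proof.
elim: z2 y z1 => [|w z2 IHz] y z1 xz.
  by rewrite big_nil (proj_q1 h) mulg1 (proj_rK h); apply: rt_refl.
have npy : p y \notin munit.
  by have [] : atom (p y) by apply/(atom_p h)/xz.1/mem_head.
have wA : atom (p w) by apply/(atom_p h)/xz.1; rewrite inE mem_cat mem_head !orbT.
set y' := r (p y) (q y * q w); set w' := r (p w) 1.
have [py' qy'] : p y' = p y /\ q y' = q y * q w by rewrite (proj_rp h) // (proj_rq h).
have perm_mid v1 v2 : perm_eq (v1 :: z1 ++ v2 :: z2) ((z1 ++ z2) ++ [:: v1; v2]).
  by rewrite perm_sym perm_catC /= perm_cons -(cat1s v2 z2) -cat1s perm_catCA.
have xz' : fac x (y' :: (z1 ++ [:: w']) ++ z2).
  split=> [v|].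
    rewrite -catA !(inE, mem_cat) => /or4P[/eqP->|vz|/eqP->|vz].
    - by apply: (atom_r h); apply/(atom_p h)/xz.1/mem_head.
    - by apply: xz.1; rewrite inE mem_cat vz orbT.
    - exact: (atom_r h).
    - by apply: xz.1; rewrite !(inE, mem_cat) vz !orbT.
  rewrite -xz.2 -catA !(perm_big _ (perm_mid _ _)) !big_cat; congr (_ * _).
  rewrite !big_cons !big_nil; apply: (proj_inj h).
    by rewrite !(proj_pM h) py' (proj_rp1 h).
  by rewrite !(proj_qM h) qy' (proj_rq1 h) (proj_q1 h) !mulg1.
apply: (@fac_chain_trans _ _ _ (y' :: (z1 ++ [:: w']) ++ z2)).
  apply: fac_chain_step => //; exists (z1 ++ z2), [:: y; w], [:: y'; w'].
  by rewrite -[(z1 ++ [:: w']) ++ z2]catA; split=> //; apply: perm_mid.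
have := IHz _ _ xz'; rewrite py' qy' -mulgA big_cons (proj_qM h).
by rewrite [map p (w :: z2)]/= [map _ (p w :: _)]/= -(cat1s (r (p w) 1)) (catA z1).
Qed.

Lemma fac_chain_lift x z : fac x z -> fac_chain 2 x z (lift_seq r (map p z) (q x)).
Proof.
case: z => [|y z] xz; first exact: rt_refl.
have := fac_chain_collect (z1 := [::]) xz; rewrite -(proj_qM h) /=.
by case: xz => _ <-; rewrite big_cons.
Qed.

(** Both are joined to their collected forms. Permuting [z'] so that it starts with the same first
    component as [z] makes these forms equal up to order. *)
Lemma fac_chain_same_p x z z' : fac x z -> fac x z' ->
  perm_eq (map p z) (map p z') -> fac_chain 2 x z z'.
Proof.
move=> xz xz' pzz'; case: z => [|y z] in xz pzz' *.
  by case: z' {xz'} pzz' => [|y z'] => [_|/perm_size //]; apply: rt_refl.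
have /mapP[y' yz' yy'] : p y \in map p z' by rewrite -(perm_mem pzz') mem_head.
have pz' := perm_to_rem yz'; set z1 := rem y' z' in pz'.
have xz1 := fac_perm pz' xz'.
apply: fac_chain_trans (fac_chain_lift xz) _.
apply: fac_chain_sym (xz') _; apply: fac_chain_trans (fac_chain_perm _ xz' pz') _.
apply: fac_chain_trans (fac_chain_lift xz1) _.
apply: fac_chain_perm; first by apply/fac_lift/fac_p.
have pz1 : perm_eq (p y :: map p z) (p y :: map p z1).
  by rewrite [in X in perm_eq _ X]yy'; apply: perm_trans pzz' (perm_map p pz').
by rewrite /= -yy' perm_cons perm_map // perm_sym -(perm_cons (p y)).
Qed.

(** The common part is lifted with second components 1 and each exchanged part carries all of [q x],
    so the common part stays common. Both exchanged parts must be non-empty for this; if one is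
    empty, so is the other. *)
Lemma fac_step_lift N x s t : fac (p x) s -> fac (p x) t -> fac_step N s t ->
  exists z z', [/\ fac x z, fac x z', perm_eq (map p z) s, perm_eq (map p z') t
                 & fac_step N z z'].
Proof.
move=> xs xt [g [a [b [pa pb sa sb]]]].
have [xga xgb] := (fac_perm pa xs, fac_perm pb xt).
have [a0|a0] := eqVneq a [::].
  have b0 : b = [::] by apply: (fac_nil_eq _ xgb); rewrite -a0.
  exists (lift_seq r s (q x)), (lift_seq r s (q x)); rewrite (lift_p h) //; last by case: xs.
  split=> //; try exact: fac_lift; first by rewrite (permPl pa) (permPr pb) a0 b0.
  by exists (lift_seq r s (q x)), [::], [::]; rewrite cats0.
have b0 : b <> [::].
  by move=> b0; case/eqP: a0; apply: (fac_nil_eq _ xga); rewrite -b0.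
have gA : atoms g by move=> v vg; apply: xga.1; rewrite mem_cat vg.
have pg : map p (map (r^~ 1) g) = g.
  by rewrite -map_comp map_id_in // => v _; rewrite /= (proj_rp1 h).
have aux c : c <> [::] -> fac (p x) (g ++ c) ->
    [/\ fac x (map (r^~ 1) g ++ lift_seq r c (q x)),
        map p (map (r^~ 1) g ++ lift_seq r c (q x)) = g ++ c
      & size (lift_seq r c (q x)) = size c].
  move=> c0 xc.
  have cA : atoms c by move=> v vc; apply: xc.1; rewrite mem_cat vc orbT.
  have E : map p (map (r^~ 1) g ++ lift_seq r c (q x)) = g ++ c.
    by rewrite map_cat pg (lift_p h).
  split=> //; last by rewrite -(size_map p) (lift_p h).
  split=> [v|].
    by move=> vz; apply/(atom_p h)/xc.1; rewrite -E map_f.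
  apply: (proj_inj h); first by rewrite (proj_p_prod h) E xc.2.
  by rewrite big_cat (proj_qM h) (prod_q_r1 h) mul1g (lift_q h) //; left.
have [xa Ea za] := aux a (elimN eqP a0) xga.
have [xb Eb zb] := aux b b0 xgb.
exists (map (r^~ 1) g ++ lift_seq r a (q x)), (map (r^~ 1) g ++ lift_seq r b (q x)).
rewrite Ea Eb; split=> //; rewrite 1?perm_sym //.
by exists (map (r^~ 1) g), (lift_seq r a (q x)), (lift_seq r b (q x)); rewrite za zb.
Qed.

(** Steps of a chain for [p x] are lifted one by one; lifts that meet over the same factorization of
    [p x] need not agree and are joined by [fac_chain_same_p]. *)
Lemma fac_chain_of_p N x : (2 <= N)%N ->
  (forall s t, fac (p x) s -> fac (p x) t -> fac_chain N (p x) s t) ->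
  forall z z', fac x z -> fac x z' -> fac_chain N x z z'.
Proof.
move=> N2 pN z z' xz xz'.
have same (w w' : seq T) : fac x w -> fac x w' -> perm_eq (map p w) (map p w') ->
  fac_chain N x w w' by move=> *; apply: fac_chain_le N2 _; apply: fac_chain_same_p.
have st := pN _ _ (fac_p xz) (fac_p xz').
suff aux s t : fac_chain N (p x) s t -> fac (p x) s -> forall w w' : seq T,
    fac x w -> fac x w' -> perm_eq (map p w) s -> perm_eq (map p w') t ->
    fac_chain N x w w'.
  by apply: (aux _ _ st) => //; apply: fac_p.
elim=> {s t st}[s t [xt st] xs|s xs|s u t su IH1 ut IH2 xs] w w' xw xw' ws wt.
- have [w1 [w2 [x1 x2 p1 p2 st12]]] := fac_step_lift xs xt st.
  apply: (@fac_chain_trans _ _ _ w1).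
    by apply: same => //; rewrite (permPl ws) perm_sym.
  apply: fac_chain_trans (fac_chain_step x2 st12) _.
  by apply: same => //; rewrite (permPl p2) perm_sym.
- by apply: same => //; rewrite (permPl ws) perm_sym.
have xu := fac_chain_fac xs su; have xl := fac_lift xu.
have lu := lift_p h (q x) xu.1.
by apply: fac_chain_trans (IH1 xs _ _ xw xl ws _) (IH2 xu _ _ xl xw' _ wt); rewrite lu.
Qed.

End ProptoProjCat.

(** * Elements of [H] with a unique factorization *)

Section UniqueFactorization.
Variables (T S D : cmonoidType) (p : T -> S) (q : T -> D) (r : S -> D -> T).
Hypothesis h : propto_proj p q r.
Implicit Types (x y w : T) (z : seq T) (s t : seq S) (U V : S) (d e f : D).

(** Over a power of one atom, choosing a factorization of [x] amounts to choosing [k] elements of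
    [D] with product [q x]; uniqueness becomes a question about [D]. *)
Lemma fac_section x U k (l : seq D) : atom U -> fac (p x) (nseq k U) ->
  size l = k -> \prod_(d <- l) d = q x -> fac x (map (r U) l).
Proof.
move=> UA [_ xE] lk lE; have [nU _] := UA; split.
  by move=> _ /mapP[d _ ->]; apply: (atom_r h).
apply: (proj_inj h).
  rewrite (proj_p_prod h) -map_comp -xE -lk; congr (\prod_(y <- _) y).
  by elim: l {lk lE} => //= d l ->; rewrite (proj_rp h).
rewrite (proj_q_prod h) -map_comp map_id_in ?lE // => d _ /=.
by rewrite (proj_rq h).
Qed.

Lemma uniq_fac_section x U k (l l' : seq D) : atom U -> uniq_fac x ->
  fac (p x) (nseq k U) -> size l = k -> size l' = k ->
  \prod_(d <- l) d = q x -> \prod_(d <- l') d = q x -> perm_eq l l'.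
Proof.
move=> UA ux xU lk lk' lE lE'; have [nU _] := UA.
have := perm_map q (ux _ _ (fac_section UA xU lk lE) (fac_section UA xU lk' lE')).
by rewrite -!map_comp !map_id_in // => d _; rewrite /= (proj_rq h).
Qed.

Lemma uniq_fac_const x U k : (forall s, fac (p x) s -> s = nseq k U) ->
  (forall l l' : seq D, size l = k -> size l' = k ->
    \prod_(d <- l) d = q x -> \prod_(d <- l') d = q x -> perm_eq l l') ->
  uniq_fac x.
Proof.
move=> pxU lP; have zE z : fac x z -> z = map (r U) (map q z) /\ size z = k.
  move=> xz; have pz := pxU _ (fac_p h xz); split.
    rewrite -map_comp -[LHS]map_id; apply/eq_in_map => y yz /=.
    by have := map_f p yz; rewrite pz => /nseqP[<- _]; rewrite (proj_rK h).
  by rewrite -(size_map p) pz size_nseq.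
move=> z z' xz xz'; have [[zU zk] [zU' zk']] := (zE z xz, zE z' xz').
rewrite zU zU'; apply/perm_map/lP; rewrite ?size_map //.
  by rewrite -(proj_q_prod h) xz.2.
by rewrite -(proj_q_prod h) xz'.2.
Qed.

Lemma uniq_fac_snd1 x : reduced D -> q x = 1 -> uniq_fac (p x) -> uniq_fac x.
Proof.
move=> Dred qx ux; have zE z : fac x z -> z = map (r^~ 1) (map p z).
  move=> [_ zx]; have /allP qz : all (fun d => d \in munit) (map q z).
    by rewrite -prod_munit -(proj_q_prod h) zx qx munit1.
  rewrite -map_comp -[LHS]map_id; apply/eq_in_map => y yz /=.
  by rewrite -(Dred _ (qz _ (map_f q yz))) (proj_rK h).
move=> z z' xz xz'; rewrite (zE z) // (zE z') //.
by apply/perm_map/ux; apply: (fac_p h).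
Qed.

(** Divisors of the unit [d] are units, so one of the two entries is 1 and the other is [d]. *)
Lemma perm_two_units (d : D) (l l' : seq D) :
  (forall e, e \in munit <-> e = 1 \/ e = d) -> size l = 2 -> size l' = 2 ->
  \prod_(e <- l) e = d -> \prod_(e <- l') e = d -> perm_eq l l'.
Proof.
move=> uD; have uprod (e f : D) : e * f = d -> [:: e; f] = [:: 1; d] \/ [:: e; f] = [:: d; 1].
  move=> efd; have : e * f \in munit by rewrite efd; apply/uD; right.
  rewrite munitM => /andP[/uD[] eE _]; [left|right]; move: efd; rewrite eE.
    by rewrite mul1g => ->.
  by rewrite -[X in _ = X]mulg1 => /cmulgI ->.
case: l l' => [|e [|f []]] // [|e' [|f' []]] // _ _.
rewrite !big_cons !big_nil !mulg1 => /uprod[]-> /uprod[]->; rewrite ?perm_refl //.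
  exact/permPl/(perm_catC [:: 1] [:: d]).
exact/permPl/(perm_catC [:: d] [:: 1]).
Qed.

Lemma perm_atom_prod (d : D) (l : seq D) : reduced D -> atom d ->
  \prod_(e <- l) e = d -> perm_eq l (d :: nseq (size l).-1 1).
Proof.
move=> Dred dA; have [nd dP] := dA; elim: l => [|e l IHl].
  by rewrite big_nil => d1; rewrite -d1 munit1 in nd.
rewrite big_cons => /[dup] eld /esym/dP[/Dred e1|ul].
  move: eld; rewrite e1 mul1g => /[dup] ld /IHl pl.
  case: l {IHl} ld pl => [|f l _ pl]; first by rewrite big_nil => d1; rewrite -d1 munit1 in nd.
  by rewrite -(perm_cons 1) in pl; rewrite (permPl pl) (perm_catCA [:: 1] [:: d] (nseq (size l) 1)).
move: eld; rewrite (Dred _ ul) mulg1 => ->; rewrite perm_cons /=.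
suff /all_pred1P -> : all (pred1 1) l by rewrite size_nseq.
by rewrite prod_munit in ul; apply: sub_all ul => f /Dred /= ->.
Qed.

(** Converse of the exceptional cases: one factorization of [p x] is lifted with different
    distributions of [q x], and uniqueness forces the resulting multisets to agree. *)
Lemma uniq_fac_cases x s0 : uniq_fac x -> fac (p x) s0 -> (2 <= size s0)%N ->
  (reduced D /\ q x = 1) \/
  exists U k, [/\ atom U, (2 <= k)%N, s0 = nseq k U &
    (k = 2 /\ forall e, e \in munit <-> e = 1 \/ e = q x) \/
    (reduced D /\ atom (q x))].
Proof.
move=> ux xs0 s02.
have [|nii] := pselect (reduced D /\ q x = 1); [by left | right].
case: s0 => // U s in xs0 s02 *.
have UA : atom U by apply/xs0.1/mem_head.
have sU : all (pred1 U) s.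
  (* A factor [V] different from [U] would reveal which of the two carries what, so [d * e = q x]
     would determine [d]; this forces [q x = 1] and [D] reduced, which was excluded. *)
  apply/allP => V Vs /=; apply/eqP; apply: contrapT => VU; case: nii.
  have VA : atom V by apply: xs0.1; rewrite inE Vs orbT.
  have [[nU _] [nV _]] := (UA, VA); set t := rem V s.
  have ps : perm_eq (U :: s) [:: U, V & t] by rewrite perm_cons perm_to_rem.
  have xUV (d e : D) : d * e = q x -> fac x [:: r U d, r V e & map (r^~ 1) t].
    move=> de; split=> [v|].
      rewrite !inE => /or3P[/eqP->|/eqP->|/mapP[W Wt ->]]; apply: (atom_r h) => //.
      by apply: xs0.1; rewrite (perm_mem ps) !inE Wt !orbT.
    rewrite !big_cons; apply: (proj_inj h).
      rewrite !(proj_pM h) !(proj_rp h) // (proj_p_prod h) -(xs0.2) (perm_big _ ps) !big_cons.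
      by rewrite -map_comp map_id_in // => W _; rewrite /= (proj_rp1 h).
    by rewrite !(proj_qM h) !(proj_rq h) // (prod_q_r1 h) mulg1.
  have same (d e d' e' : D) : d * e = q x -> d' * e' = q x -> d = d'.
    move=> /xUV x1 /xUV x2; pose t1 := map (r^~ 1) t.
    have : perm_eq ([:: r U d; r V e] ++ t1) ([:: r U d'; r V e'] ++ t1) := ux _ _ x1 x2.
    rewrite perm_cat2r => /perm_mem/(_ (r U d)); rewrite !inE eqxx.
    case/esym/orP => /eqP E; last by case: VU; rewrite -(proj_rp h d nU) E (proj_rp h).
    by rewrite -(proj_rq h d nU) E (proj_rq h).
  have qx1 : q x = 1 by apply: (same (q x) 1 1 (q x)); rewrite ?mulg1 ?mul1g.
  split=> // e /munitP[f ef]; apply: (same e f 1 1); rewrite ?mulg1 qx1 //.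
have s0E : U :: s = nseq (size s).+1 U by rewrite /= -(all_pred1P _ _ sU).
exists U, (size s).+1; split=> //.
case: s => // V s in xs0 s02 sU s0E *; set k := size s in s0E *.
rewrite s0E in xs0; have comparison := uniq_fac_section UA ux xs0.
have prod1 n : \prod_(f <- nseq n (1 : D)) f = 1.
  by rewrite (prod_map_expg (all_pred1_nseq _ _)) expg1n.
(* Now only the multiset of second components is visible: two splittings of [q x], padded by 1,
   agree up to order. *)
have same (d e d' e' : D) : d * e = q x -> d' * e' = q x -> d \in [:: d'; e'].
  move=> de de'; suff <- : [:: d; e] =i [:: d'; e'] by rewrite mem_head.
  apply/perm_mem; rewrite -(perm_cat2r (nseq k 1)); apply: comparison.
  - by rewrite /= size_nseq.
  - by rewrite /= size_nseq.
  - by rewrite !big_cons mulgA de prod1 mulg1.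
  - by rewrite !big_cons mulgA de' prod1 mulg1.
have [Dred|nDred] := pselect (reduced D).
  right; split=> //; split=> [|a b qab].
    by apply/negP => /Dred qx1; case: nii.
  have := same (q x) 1 a b; rewrite mulg1 qab !inE => /(_ erefl erefl)/orP[]/eqP.
    rewrite -[X in _ = X]mulg1 => /cmulgI ->; right; exact: munit1.
  rewrite -[X in _ = X]mul1g => /mulgIc ->; left; exact: munit1.
(* A unit [e] with inverse [f] splits [q x] as [e * (f * q x)], to be compared with [q x * 1]. *)
left; have uE (e : D) : e \in munit -> e <> 1 -> e = q x.
  move=> /munitP[f ef] e1; have := same e (f * q x) (q x) 1.
  rewrite mulgA ef mul1g mulg1 !inE => /(_ erefl erefl)/orP[]/eqP //.
have [e ue e1] : exists2 e : D, e \in munit & e <> 1.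
  apply: contrapT => ne; apply: nDred => e ue; apply: contrapT => e1.
  by apply: ne; exists e.
have qe := uE e ue e1; have uq : q x \in munit by rewrite -qe.
have nq1 : q x <> 1 by rewrite -qe.
have qq : q x * q x = 1.
  apply: contrapT => /(uE _ _); rewrite munitM uq => /(_ isT).
  by rewrite -[X in _ = X]mulg1 => /cmulgI.
split; last first.
  move=> f; split=> [uf|[]->] //; last exact: munit1.
  by have [->|/eqP/(uE f uf)] := eqVneq f 1; [left | right].
(* With three or more factors, [q x, 1, 1] and [q x, q x, q x] would have the same product, since
   [q x] squares to 1. *)
congr _.+2; apply/eqP/contraT; rewrite -lt0n => k0; exfalso; apply: nq1.
have : perm_eq ([:: q x; 1; 1] ++ nseq k.-1 1) ([:: q x; q x; q x] ++ nseq k.-1 1).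
  apply: comparison.
  - by rewrite /= size_nseq prednK.
  - by rewrite /= size_nseq prednK.
  - by rewrite !big_cons !mul1g prod1 mulg1.
  - by rewrite !big_cons !mulgA qq mul1g prod1 mulg1.
rewrite perm_cat2r => /perm_mem/(_ 1); rewrite !inE eqxx !orbb orbT.
by move=> /esym/eqP ->.
Qed.

End UniqueFactorization.

(** * Passage to the reduced monoid *)

Section ReducedProj.
Variables (T S D : cmonoidType) (p : T -> S) (q : T -> D) (r : S -> D -> T).
Hypothesis h : propto_proj p q r.
Implicit Types (x y : T) (X Y : red T).

Definition red_fst X : red S := cls (p (repr X)).
Definition red_snd X : D := q (repr X).
Definition red_mk (U : red S) (d : D) : red T := cls (r (repr U) d).

Lemma red_fst_snd_cls x : red_fst (cls x) = cls (p x) /\ red_snd (cls x) = q x.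
Proof.
have /clsP[e ue] := clsK (cls x); rewrite /red_fst /red_snd.
move: (repr (cls x)) => y ->; split.
  by apply/clsP; exists (p e); rewrite ?(munit_p h) // (proj_pM h).
by rewrite (proj_qM h) (proj_unit h (x := e)) ?(munit_p h) // mulg1.
Qed.

Lemma red_fst_cls x : red_fst (cls x) = cls (p x).
Proof. exact: (red_fst_snd_cls x).1. Qed.
Lemma red_snd_cls x : red_snd (cls x) = q x.
Proof. exact: (red_fst_snd_cls x).2. Qed.

Lemma red_proj : propto_proj red_fst red_snd red_mk.
Proof.
split.
- split; first by rewrite -cls1 red_fst_cls (proj_p1 h).
  move=> X Y; rewrite -[X]clsK -[Y]clsK -clsM !red_fst_cls -clsM.
  by rewrite (proj_pM h).
- split; first by rewrite -cls1 red_snd_cls (proj_q1 h).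
  by move=> X Y; rewrite -[X]clsK -[Y]clsK -clsM !red_snd_cls (proj_qM h).
- move=> X Y; rewrite -[X]clsK -[Y]clsK !red_fst_cls !red_snd_cls.
  move: (repr X) (repr Y) => x y /clsP[e ue pyE] qxy; apply/clsP; exists (r e 1).
    by rewrite -(munit_p h) (proj_rp1 h).
  apply: (proj_inj h); first by rewrite (proj_pM h) (proj_rp1 h).
  by rewrite (proj_qM h) (proj_rq1 h) mulg1.
- move=> X; rewrite -[X]clsK red_fst_cls red_snd_cls munit_cls; exact: (proj_unit h).
move=> U d Ud; rewrite red_fst_cls red_snd_cls.
have [|-> ->] := proj_section h (a := repr U) (d := d); last by rewrite clsK.
by rewrite munit_repr.
Qed.

End ReducedProj.

(** * Omega, tau and tame degree of [H] compared with those of [H_0] *)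

Section OmegaTauTame.
Variables (T S D : cmonoidType) (p : T -> S) (q : T -> D) (r : S -> D -> T).
Hypothesis h : propto_proj p q r.
Let h' := red_proj h.
Implicit Types (x y : T) (u : S) (d e : D).

Lemma omega_p_le x : x \notin munit -> enat_le (omega (p x)) (omega x).
Proof.
move=> nx; apply: enat_le_ext => n /omega_leP xn; apply/omega_leP.
exact: (omega_bound_p h).
Qed.

Lemma omega_q_le x : atom x -> enat_le (omega (q x)) (omega x).
Proof.
move=> xA; apply: enat_le_ext => n /omega_leP xn; apply/omega_leP.
exact: (omega_bound_q h).
Qed.

Lemma tame_p_le x : x \notin munit -> enat_le (tame (cls (p x))) (tame (cls x)).
Proof.
move=> nx; apply: enat_le_ext => n /tame_leP xn; apply/tame_leP.
by rewrite -(red_fst_cls h); apply: (tame_bound_p h'); rewrite ?munit_cls.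
Qed.

(** The correction secures the bound 2 required by [omega_bound_lift]. The value at [p x] is at
    least 1, and at least 2 if [p x] is not prime; the value at [q x] is at least 1 if [q x] is not
    a unit. Only for prime [p x] and unit [q x] can the sum be 1. *)
Lemma omega_le_sum x : atomic S -> atomic D -> atom x ->
  enat_le (omega x) (enat_add (enat_add (omega (p x)) (omega (q x)))
    (if `[< mprime (p x) /\ q x \in munit >] then Fin 1 else Fin 0)).
Proof.
move=> Sat Dat xA; have pxA : atom (p x) by apply/(atom_p h).
case e1: (omega (p x)) => [n1|]; last exact: enat_leInfty.
case e2: (omega (q x)) => [n2|]; last by rewrite /= enat_leInfty.
have b1 : omega_bound (p x) n1 by apply/omega_leP; rewrite e1; apply: enat_le_refl.
have b2 : omega_bound (q x) n2 by apply/omega_leP; rewrite e2; apply: enat_le_refl.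
have n1_gt0 := omega_ge1 Sat pxA.1 b1.
case: asboolP => [pq|npq] /=; apply/omega_leP; apply: (omega_bound_lift h Dat xA b1 b2).
- exact: leq_addr.
- by rewrite addn1 ltnS addn_gt0 n1_gt0.
- exact: leq_addr.
rewrite addn0; have [uq|nq] := boolP (q x \in munit).
  have npx : ~ mprime (p x) by move=> px; apply: npq.
  by apply: leq_trans (omega_ge2_nonprime Sat pxA npx b1) (leq_addr _ _).
exact: (leq_add n1_gt0 (omega_ge1 Dat nq b2)).
Qed.

Lemma omega_finite x : atomic S -> atomic D -> atom x ->
  omega x <> Infty <-> omega (p x) <> Infty /\ omega (q x) <> Infty.
Proof.
move=> Sat Dat xA; split=> [xf|[pf qf] xI].
  split=> e; apply/xf/enat_Infty_le; rewrite -e; first exact: omega_p_le xA.1.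
  exact: omega_q_le.
have := omega_le_sum Sat Dat xA; rewrite xI => /enat_Infty_le.
by case: (omega (p x)) pf => // n1 _; case: (omega (q x)) qf => // n2 _; case: asboolP.
Qed.

(** Atoms of [H] have arbitrary second components, so arbitrarily high powers of an atom of [D]
    occur there. *)
Lemma omegaS_Infty u : atomic D -> ~ is_group D -> atom u -> omegaS T = Infty.
Proof.
move=> Dat nD uA; have [v vA] := atomic_exists_atom Dat nD.
have [nu _] := uA; apply: enat_sup_Infty => n; pose x := r u (v ^+ n.+1).
have xA : atom x by apply: (atom_r h).
exists (omega x); first by exists x.
move=> /omega_leP/(omega_bound_q h xA); rewrite (proj_rq h) //.
by move=> /(omega_bound_expg vA); rewrite ltnn.
Qed.

Lemma tameS_Infty u : atomic D -> ~ is_group D -> atom u -> tameS T = Infty.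
Proof.
move=> Dat nD uA; have [v vA] := atomic_exists_atom Dat nD.
have [[nu _] [nv _]] := (uA, vA); apply: enat_sup_Infty => n.
(* An exponent of at least 2 makes the power different from [v], as [tame_bound_expg] demands. *)
pose x := r u (v ^+ n.+2).
have xA : atom x by apply: (atom_r h).
exists (tame (cls x)); first by exists (cls x) => //; apply/atom_cls.
move=> /tame_leP.
have qx : red_snd q (cls x) = v ^+ n.+2 by rewrite (red_snd_cls h) (proj_rq h).
have vn : v <> v ^+ n.+2.
  rewrite expgS -{1}(mulg1 v) => /cmulgI e1.
  by have := expg_nonunit n nv; rewrite -e1 munit1.
by move=> /(tame_bound_expg h' ((atom_cls x).2 xA) vA qx vn); rewrite ltnNge leqnSn.
Qed.

Section GroupD.
Hypotheses (Sat : atomic S) (Dgrp : is_group D) (nD : ~ (forall d, d = 1)).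

Lemma group_atomic : atomic D.
Proof.
move=> d; exists [::]; rewrite big_nil; split=> //; have /munitP[e de] := Dgrp d.
by exists e; [apply/munitP; exists d; rewrite cmulgC | rewrite de].
Qed.

Lemma omega_lift_le x : atom x -> enat_le (omega x) (enat_max (Fin 2) (omega (p x))).
Proof.
move=> xA; apply: enat_le_ext => n; rewrite enat_max_le => /andP[n2 /omega_leP b1].
apply/omega_leP; apply: (omega_bound_lift h group_atomic xA b1 _ _ n2).
  exact: omega_bound_munit (Dgrp _).
by rewrite addn0.
Qed.

Lemma omega_group_ge2 x : atom x -> enat_le (Fin 2) (omega x).
Proof.
move=> xA; have [y [yA xy nxy]] := square_multiple h Dgrp xA nD.
apply: enat_le_ext => n /omega_leP; apply: (omega_bound_ge2 (s := [:: y; y]) xA.1).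
- by move=> v; rewrite !inE orbb => /eqP->.
- by rewrite big_cons big_seq1.
by move=> v; rewrite !inE orbb => /eqP->.
Qed.

Lemma tame_group_ge2 x : atom x -> enat_le (Fin 2) (tame (cls x)).
Proof.
move=> xA; have [y [yA xy nxy]] := square_multiple h Dgrp xA nD.
apply: enat_le_ext => n /tame_leP.
apply: (tame_bound_ge2 (s := [:: cls y; cls y])); first by rewrite munit_cls; case: xA.
- by move=> v; rewrite !inE orbb => /eqP->; apply/atom_cls.
- by rewrite big_cons big_seq1 -clsM; apply/mdvd_cls.
by move=> v; rewrite !inE orbb => /eqP-> /mdvd_cls.
Qed.

Lemma tame_lift_le x : atom x ->
  enat_le (tame (cls x)) (enat_max (Fin 2) (tame (cls (p x)))).
Proof.
move=> xA; apply: enat_le_ext => n; rewrite enat_max_le => /andP[n2 /tame_leP b1].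
apply/tame_leP; rewrite -(maxn_idPr n2); apply: (tame_bound_lift h' Dgrp).
  exact/atom_cls.
by rewrite (red_fst_cls h).
Qed.

Lemma prime_case x : atom x -> mprime (p x) ->
  [/\ omega x = Fin 2, tau x = Fin 1 & tame (cls x) = Fin 2].
Proof.
move=> xA px; split; apply: enat_le_anti.
- apply: enat_le_trans (omega_lift_le xA) _; rewrite enat_max_le enat_le_refl /=.
  apply: (@enat_le_trans (Fin 1)) => //; apply/omega_leP; exact: omega_bound_prime.
- exact: omega_group_ge2.
- apply: enat_le_trans (tau_lift_le h Dgrp xA) _; rewrite enat_max_le enat_le_refl /=.
  exact: tau_prime_le1.
- exact: (tau_ge1 h Dgrp).
- apply: enat_le_trans (tame_lift_le xA) _; rewrite enat_max_le enat_le_refl /=.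
  apply: (@enat_le_trans (Fin 0)) => //; apply/tame_leP; apply: tame_bound_prime.
    exact: reduced_red.
  exact: mprime_cls.
exact: tame_group_ge2.
Qed.

(** A non-prime atom [p x] already has omega and tame degree at least 2 and tau at least 1, so the
    constants in the upper bounds are absorbed. *)
Lemma nonprime_case x : atom x -> ~ mprime (p x) ->
  [/\ omega x = omega (p x), tau x = tau (p x) & tame (cls x) = tame (cls (p x))].
Proof.
move=> xA npx; have pxA : atom (p x) by apply/(atom_p h).
split; apply: enat_le_anti.
- apply: enat_le_trans (omega_lift_le xA) _; rewrite enat_max_le enat_le_refl andbT.
  apply: enat_le_ext => n /omega_leP; exact: omega_ge2_nonprime.
- exact: omega_p_le xA.1.
- apply: enat_le_trans (tau_lift_le h Dgrp xA) _; rewrite enat_max_le enat_le_refl andbT.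
  exact: tau_ge1_nonprime.
- exact: (tau_p h xA.1).
- apply: enat_le_trans (tame_lift_le xA) _; rewrite enat_max_le enat_le_refl andbT.
  apply: enat_le_ext => n /tame_leP.
  have [s [sA us nus]] := nonprime_dvd_prod Sat pxA npx.
  apply: (tame_bound_ge2 (s := map (@cls S) s)); first by rewrite munit_cls; case: pxA.
  + by move=> _ /mapP[v /sA vA ->]; apply/atom_cls.
  + by rewrite big_map -cls_prod; apply/mdvd_cls.
  by move=> _ /mapP[v /nus nv ->] /mdvd_cls.
exact: tame_p_le xA.1.
Qed.

Lemma sup_group_case u0 : atom u0 ->
  [/\ tameS T = enat_max (Fin 2) (tameS S), omegaS T = enat_max (Fin 2) (omegaS S)
    & tauS T = enat_max (Fin 1) (tauS S)].
Proof.
move=> u0A.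
have rP u : atom u -> exists2 x, atom x & p x = u.
  by move=> uA; exists (r u 1); [apply: (atom_r h) | rewrite (proj_rp1 h)].
have exA : exists x : T, atom x by have [x xA _] := rP _ u0A; exists x.
have pA x : atom x -> atom (p x) by move=> xA; apply/(atom_p h).
split.
- apply: (enat_sup_proj (pr := red_fst p)).
  + by have [x /atom_cls xA] := exA; exists (cls x).
  + by move=> X /(atom_p h').
  + move=> U UA; have [x xA pxU] := rP _ (atom_repr UA).
    by exists (cls x); [apply/atom_cls | rewrite (red_fst_cls h) pxU clsK].
  + by move=> X; rewrite -[X]clsK => /atom_cls; apply: tame_group_ge2.
  + by move=> X; rewrite -[X]clsK (red_fst_cls h) => /atom_cls[nX _]; apply: tame_p_le.
  + by move=> X; rewrite -[X]clsK (red_fst_cls h) => /atom_cls; apply: tame_lift_le.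
- apply: (enat_sup_proj exA pA rP omega_group_ge2 _ omega_lift_le).
  by move=> x [nx _]; apply: omega_p_le.
apply: (enat_sup_proj exA pA rP).
- by move=> x xA; apply: (tau_ge1 h Dgrp).
- by move=> x [nx _]; apply: (tau_p h).
- exact: (tau_lift_le h Dgrp).
Qed.

End GroupD.
End OmegaTauTame.

(** * Catenary degrees of [H] and [H_0] *)

Section CatenaryDegreeProj.
Variables (T S D : cmonoidType) (p : T -> S) (q : T -> D) (r : S -> D -> T).
Hypothesis h : propto_proj p q r.
Let h' := red_proj h.
Implicit Types (x y : T) (a u : S) (d e : D).

Lemma cat_p_le x : enat_le (cat_deg (p x)) (cat_deg x).
Proof.
apply: enat_le_ext => n /cat_leP xn; apply/cat_leP; rewrite -(red_fst_cls h) => s t xs xt.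
rewrite -(lift_p h' (red_snd q (cls x)) xs.1) -(lift_p h' (red_snd q (cls x)) xt.1).
by apply: (fac_chain_p h'); apply: xn; apply: (fac_lift h').
Qed.

Lemma cat_lift_le x : enat_le (cat_deg x) (enat_max (Fin 2) (cat_deg (p x))).
Proof.
apply: enat_le_ext => n; rewrite enat_max_le => /andP[n2 /cat_leP pn].
apply/cat_leP => s t; apply: (fac_chain_of_p h' n2).
by rewrite (red_fst_cls h).
Qed.

Lemma Zof_nseq a u k s : Zof a = [set msetn k (cls u)]%classic ->
  fac (cls a) s -> s = nseq k (cls u).
Proof.
move=> Za /fac_ZofP; rewrite Za /= => sE.
have ps : perm_eq s (nseq k (cls u)).
  by rewrite -(permPl (perm_eq_seq_mset s)) sE enum_msetn.
have /all_pred1P -> : all (pred1 (cls u)) s by rewrite (perm_all _ ps) all_pred1_nseq.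
by rewrite (perm_size ps) size_nseq.
Qed.

Lemma uniq_Zof a u k : uniq_fac (cls a) -> fac (cls a) (nseq k (cls u)) ->
  Zof a = [set msetn k (cls u)]%classic.
Proof.
move=> ua au; apply/seteqP; split=> [z az|_ ->] /=; last first.
  by apply/ZofP; rewrite enum_msetn.
rewrite -[z]seq_mset_id -[msetn _ _]seq_mset_id enum_msetn.
by apply/eq_seq_msetP/ua => //; apply/ZofP.
Qed.

Section Cases.
Variable x : T.

Let case_i :=
  (forall e : D, e \in munit <-> e = 1 \/ e = q x) /\
  (exists2 u : S, atom u & Zof (p x) = [set msetn 2 (cls u)]%classic).
Let case_ii := [/\ reduced D, q x = 1 & cat_deg (p x) = Fin 0].
Let case_iii :=
  [/\ reduced D, atom (q x)
    & exists (u : S) (k : nat),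
        [/\ atom u, (2 <= k)%N & Zof (p x) = [set msetn k (cls u)]%classic]].

Lemma cat_deg_cases : case_i \/ case_ii \/ case_iii -> cat_deg x = Fin 0.
Proof.
move=> cases; apply: cat_deg_uniq.
case: cases => [[uD [u _ Zu]]|[[Dred qx c0]|[Dred qA [u [k [_ _ Zu]]]]]].
- apply: (uniq_fac_const h' (U := cls u) (k := 2)).
    by rewrite (red_fst_cls h) => s; apply: Zof_nseq.
  by rewrite (red_snd_cls h) => l l'; apply: perm_two_units.
- apply: (uniq_fac_snd1 h' Dred); first by rewrite (red_snd_cls h).
  by rewrite (red_fst_cls h); apply: cat_deg0_uniq.
apply: (uniq_fac_const h' (U := cls u) (k := k)).
  by rewrite (red_fst_cls h) => s; apply: Zof_nseq.
rewrite (red_snd_cls h) => l l' lk l'k /(perm_atom_prod Dred qA) pl /(perm_atom_prod Dred qA) pl'.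
by rewrite (permPl pl) (permPr pl') lk l'k.
Qed.

(** Only the lower bound 2 is at stake: below it [x] would have a unique factorization, and
    [uniq_fac_cases] would yield an exceptional case. *)
Lemma cat_deg_other : atomic S -> p x \notin munit -> ~ atom (p x) ->
  ~ (case_i \/ case_ii \/ case_iii) -> cat_deg x = enat_max (Fin 2) (cat_deg (p x)).
Proof.
move=> Sat npx naPx ncases; apply: enat_le_anti (cat_lift_le x) _.
rewrite enat_max_le cat_p_le andbT; apply: cat_deg_ge2 => ux; apply: ncases.
have [s sA sE] := atomic_prod Sat npx.
have xs : fac (red_fst p (cls x)) (map (@cls S) s).
  split; first by move=> _ /mapP[v /sA vA ->]; apply/atom_cls.
  by rewrite (red_fst_cls h) sE big_map cls_prod.
have s2 : (2 <= size (map (@cls S) s))%N.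
  rewrite size_map; case: s sA sE {xs} => [|v [|//]] sA sE.
    by move: npx; rewrite sE big_nil munit1.
  by case: naPx; rewrite sE big_seq1; apply/sA/mem_head.
have upx : uniq_fac (cls (p x)) by rewrite -(red_fst_cls h); apply: (uniq_fac_p h').
have := uniq_fac_cases h' ux xs s2; rewrite (red_snd_cls h).
case=> [[Dred qx]|[U [k [UA k2 sU]]]].
  by right; left; split=> //; apply: cat_deg_uniq.
have Zu : Zof (p x) = [set msetn k (cls (repr U))]%classic.
  by apply: uniq_Zof => //; rewrite clsK -sU -(red_fst_cls h).
have uA := atom_repr UA.
case=> [[k_2 uD]|[Dred qA]]; [left|right; right].
  by split=> //; exists (repr U) => //; rewrite Zu k_2.
by split=> //; exists (repr U), k.
Qed.

End Cases.

Lemma cat_degS_proj u : atom u -> ~ (forall d, d = 1) ->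
  cat_degS T = enat_max (Fin 2) (cat_degS S).
Proof.
move=> uA /existsNP[d d1]; apply: enat_le_anti.
  apply/enat_sup_le => _ [x ->]; apply: enat_le_trans (cat_lift_le x) _.
  rewrite enat_max_le enat_le_maxl /=; apply: enat_le_trans (enat_le_maxr _ _).
  by apply: enat_le_sup; exists (p x).
rewrite enat_max_le; apply/andP; split; last first.
  apply/enat_sup_le => _ [a ->].
  apply: (@enat_le_trans (cat_deg (r a 1))); last by apply: enat_le_sup; exists (r a 1).
  by rewrite -{1}(proj_rp1 h a); apply: cat_p_le.
have [nu _] := uA; have nu3 : u * (u * u) \notin munit by rewrite munitM negb_and nu.
(* Over the cube of [u] the second components [d, d, 1] and [d * d, 1, 1] give two factorizations,
   told apart by the number of entries 1, for any [d <> 1]. *)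
pose x := r (u * (u * u)) (d * d).
apply: (@enat_le_trans (cat_deg x)); last by apply: enat_le_sup; exists x.
apply: cat_deg_ge2 => ux.
have xu : fac (red_fst p (cls x)) (nseq 3 (cls u)).
  split; first by move=> v /nseqP[-> _]; apply/atom_cls.
  by rewrite (red_fst_cls h) (proj_rp h) // [nseq 3 _]/= !big_cons big_nil mulg1 !clsM.
have UA : atom (cls u) by apply/atom_cls.
have := uniq_fac_section h' UA ux xu (l := [:: d; d; 1]) (l' := [:: d * d; 1; 1]) erefl erefl.
rewrite (red_snd_cls h) (proj_rq h) // !big_cons big_nil !mulg1 => /(_ erefl erefl).
move=> /permP/(_ (pred1 1)) /=; rewrite eqxx; move/eqP: d1 => /negPf->.
by case: (_ == _).
Qed.

End CatenaryDegreeProj.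

(** * Quotient group, complete integral closure and the Krull property *)

Section QuotientGroupProj.
Variables (T S D : cmonoidType) (p : T -> S) (q : T -> D) (r : S -> D -> T).
Hypothesis h : propto_proj p q r.
Variables (c : S) (nc : c \notin munit).
Implicit Types (x y : T) (a b : S) (d e : D).

Lemma qfrac_expg (M : cmonoidType) (a b : M) n : qfrac a b ^+ n = qfrac (a ^+ n) (b ^+ n).
Proof.
elim: n => [|n IHn]; first by rewrite !expg0.
by rewrite !expgS IHn -qfrac_mul.
Qed.

Lemma cicP (M : cmonoidType) (a b : M) : cic M (qfrac a b) <->
  exists m : M, forall n, exists s, m * a ^+ n = s * b ^+ n.
Proof.
have E (m s : M) n : qincl m * qfrac a b ^+ n = qincl s <-> m * a ^+ n = s * b ^+ n.
  rewrite qfrac_expg [X in X = _]qfrac_mul qfracP mul1g mulg1; exact: iff_refl.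
by split=> -[m mP]; exists m => n; have [s /E sE] := mP n; exists s.
Qed.

Definition quot_proj (X : qgroup T) : (qgroup S * qgroup D)%type :=
  (qfrac (p (repr X).1) (p (repr X).2), qfrac (q (repr X).1) (q (repr X).2)).

Lemma quot_proj_qfrac x y :
  quot_proj (qfrac x y) = (qfrac (p x) (p y), qfrac (q x) (q y)).
Proof.
have /qfracP e := qfracK (qfrac x y); congr pair; apply/qfracP.
  by rewrite -!(proj_pM h) e.
by rewrite -!(proj_qM h) e.
Qed.

Lemma quot_proj_morph : monoid_morphism quot_proj.
Proof.
split; first by rewrite [1]/(qfrac 1 1) quot_proj_qfrac (proj_p1 h) (proj_q1 h).
move=> X Y; rewrite -[X]qfracK -[Y]qfracK [X in quot_proj X]qfrac_mul !quot_proj_qfrac.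
by rewrite !(proj_pM h) !(proj_qM h) -!qfrac_mul.
Qed.

(** Enlarging a fraction in [S] by the non-unit [c] brings numerator and denominator into the range
    where [r] is a section, without changing its value. *)
Definition quot_lift (Z : qgroup S * qgroup D) : qgroup T :=
  qfrac (r (c * (repr Z.1).1) (repr Z.2).1) (r (c * (repr Z.1).2) (repr Z.2).2).

Lemma mul_nonunit a : c * a \notin munit.
Proof. by rewrite munitM negb_and nc. Qed.

Lemma quot_liftK : cancel quot_lift quot_proj.
Proof.
move=> [u v]; rewrite quot_proj_qfrac !(proj_rp h) ?mul_nonunit //.
rewrite !(proj_rq h) ?mul_nonunit // qfracK -[in RHS](qfracK u).
by congr pair; apply/qfracP; rewrite -!mulgA (cmulgC c) (cmulgC c) -!mulgA (cmulgC _ c).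
Qed.

Lemma quot_proj_inj : injective quot_proj.
Proof.
move=> X Y; rewrite -[X]qfracK -[Y]qfracK !quot_proj_qfrac => -[/qfracP pE /qfracP qE].
by apply/qfracP; apply: (proj_inj h); rewrite ?(proj_pM h) ?(proj_qM h).
Qed.

Lemma quot_proj_bij : bijective quot_proj.
Proof.
exists quot_lift; last exact: quot_liftK.
by move=> X; apply: quot_proj_inj; rewrite quot_liftK.
Qed.

Lemma quot_proj_qincl x : quot_proj (qincl x) = (qincl (p x), qincl (q x)).
Proof. by rewrite quot_proj_qfrac (proj_p1 h) (proj_q1 h). Qed.

Lemma proj_pX x n : p (x ^+ n) = p x ^+ n.
Proof. by elim: n => [|n IHn]; rewrite ?expg0 ?(proj_p1 h) // !expgS (proj_pM h) IHn. Qed.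
Lemma proj_qX x n : q (x ^+ n) = q x ^+ n.
Proof. by elim: n => [|n IHn]; rewrite ?expg0 ?(proj_q1 h) // !expgS (proj_qM h) IHn. Qed.

Lemma quot_proj_cic : (quot_proj @` cic T = cic S `*` cic D)%classic.
Proof.
apply/seteqP; split=> [_ [X TX <-]|[u v] [/=]].
  move: TX; rewrite -[X]qfracK quot_proj_qfrac => /cicP[m mP]; split; apply/cicP.
    exists (p m) => n; have [s sE] := mP n; exists (p s).
    by rewrite -!proj_pX -!(proj_pM h) sE.
  exists (q m) => n; have [s sE] := mP n; exists (q s).
  by rewrite -!proj_qX -!(proj_qM h) sE.
have [X XE] : exists X, quot_proj X = (u, v) by exists (quot_lift (u, v)); apply: quot_liftK.
move: XE; rewrite -[X]qfracK quot_proj_qfrac; move: (repr X).1 (repr X).2 => x y.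
move=> [<- <-] /cicP[m mP] /cicP[m' mP'].
exists (qfrac x y); last exact: quot_proj_qfrac.
(* The two multipliers are paired after enlarging the first by [c]; the same [c] makes each
   [(c * s, s')] an element of [T]. *)
apply/cicP; exists (r (c * m) m') => n.
have [[s sE] [s' sE']] := (mP n, mP' n); exists (r (c * s) s').
apply: (proj_inj h).
  by rewrite !(proj_pM h) !proj_pX !(proj_rp h) ?mul_nonunit // -!mulgA sE.
by rewrite !(proj_qM h) !proj_qX !(proj_rq h) ?mul_nonunit // sE'.
Qed.

Variables (d : D) (d1 : d <> 1).

Let x0 := r c 1.
Let y0 := r c d.

Lemma not_dvd_x0y0 : ~ mdvd x0 y0.
Proof.
move=> /(mdvd_same_p h _) yx; apply: d1.
by rewrite -(proj_rq h d nc) -/y0 yx ?(proj_rq1 h) // !(proj_rp h).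
Qed.

(** Multiplication by [x0] brings every power of [y0 / x0] into [T], although this fraction, the
    pair [(1, d)], is not in [T]. *)
Lemma x0y0_powers n : x0 * y0 ^+ n = r c (d ^+ n) * x0 ^+ n.
Proof.
apply: (proj_inj h).
  by rewrite !(proj_pM h) !proj_pX !(proj_rp h).
by rewrite !(proj_qM h) !proj_qX !(proj_rq h) // expg1n mul1g mulg1.
Qed.

Lemma not_cic : ~ completely_integrally_closed T.
Proof.
move=> Tcic; have : cic T (qfrac y0 x0).
  by apply/cicP; exists x0 => n; exists (r c (d ^+ n)); apply: x0y0_powers.
rewrite Tcic => -[s _ /qfracP sE]; apply: not_dvd_x0y0.
by exists s; rewrite cmulgC sE mulg1.
Qed.

(* [x0 y0^n] is divisible by [x0^n] for all [n], so in a free abelian monoid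
   the image of [x0] divides that of [y0]. *)
Lemma not_krull : ~ krull T.
Proof.
move=> [P [phi [[phi1 phiM] phi_dvd]]]; apply: not_dvd_x0y0; apply: phi_dvd.
have mulE (A B : {mset P}%mset) i : (A * B) i = (A i + B i)%N.
  by rewrite -[LHS]/((A `+` B)%mset i) msetE2.
have powE x n i : phi (x ^+ n) i = (n * phi x i)%N.
  elim: n => [|n IHn]; first by rewrite expg0 phi1 -[LHS]/(@mset0 P i) mset0E.
  by rewrite expgS phiM mulE IHn mulSn.
exists (phi y0 `\` phi x0)%mset; rewrite -[RHS]/(phi x0 `+` (phi y0 `\` phi x0))%mset.
rewrite msetBDKC //; apply/msubsetP => i; rewrite leqNgt; apply/negP => lt_yx.
(* For this [n] the single summand [phi x0 i] cannot make up for a deficit of at least 1 in each of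
   [n] copies of [y0]. *)
set n := (phi x0 i).+1; have := congr1 (fun A => phi A i) (x0y0_powers n).
rewrite /= !phiM !mulE !powE => E.
have : (n * (phi y0 i).+1 <= phi x0 i + n * phi y0 i)%N.
  by rewrite E; apply: leq_trans (leq_addl _ _); rewrite leq_mul2l lt_yx orbT.
by rewrite mulnS leq_add2r ltnn.
Qed.

End QuotientGroupProj.

(** * The monoid of the statement *)

Section ProptoInstance.
Variables H0 D : cmonoidType.

Definition propto_snd (x : propto H0 D) : D := (val x).2.
(** [insubd] sends pairs outside [H] to 1; [proj_section] speaks only of pairs inside. *)
Definition propto_mk (a : H0) (d : D) : propto H0 D := insubd 1 (a, d).

Lemma propto_proj_propto :
  propto_proj (@propto_fst H0 D : propto H0 D -> H0) propto_snd propto_mk.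
Proof.
split.
- by split=> [|x y]; rewrite /propto_fst ?val1 ?valM.
- by split=> [|x y]; rewrite /propto_snd ?val1 ?valM.
- move=> x y xy1 xy2; apply: val_inj; rewrite [val x]surjective_pairing.
  by rewrite [val y]surjective_pairing; congr pair.
- move=> x ux; have := valP x; rewrite inE /= -/(propto_fst x) ux /=.
  by move/eqP.
move=> a d ad; have ad_in : (a, d) \in @propto_pred H0 D.
  by rewrite inE /=; case: (a \in munit) ad => //= -[//|->].
by rewrite /propto_fst /propto_snd /propto_mk val_insubd ad_in.
Qed.

(** [(a, 1)] divides [(a, d)] in the product, but the quotient [(1, d)] is outside [H]. *)
Lemma propto_not_saturated (a : H0) (d : D) : a \notin munit -> d <> 1 ->
  ~ saturated (@propto_pred H0 D).
Proof.
move=> na d1 sat.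
have [|||[e f] ef [aE dE]] := sat (a, 1) (a, d).
- by rewrite inE /= na.
- by rewrite inE /= na.
- by exists (1, d); congr pair; rewrite ?mulg1 ?mul1g.
apply: d1.
have e1 : e = 1 by apply: (@cmulgI _ a); rewrite mulg1 -aE.
by move: ef; rewrite dE inE /= e1 munit1 mul1g /= => /eqP.
Qed.

End ProptoInstance.

Theorem proposition6p1 (H0 D : cmonoidType) :
  monoid_closed (@propto_pred H0 D) /\
  ((forall d : D, d = 1) \/ is_group H0 ->
     forall x : H0 * D, x \in @propto_pred H0 D <-> x.2 = 1) /\
  (~ (forall d : D, d = 1) -> ~ is_group H0 ->
   let H : cmonoidType := propto H0 D in
   (* 1 *)
   (forall x : H, x \in munit <-> (val x).1 \in munit /\ (val x).2 = 1) /\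
   (* 2 *)
   ((exists f : qgroup H -> (qgroup H0 * qgroup D)%type,
       [/\ monoid_morphism f, bijective f,
           forall x : H, f (qincl x) = (qincl (val x).1, qincl (val x).2)
         & (f @` cic H = cic H0 `*` cic D)%classic]) /\
    ~ saturated (@propto_pred H0 D) /\
    ~ completely_integrally_closed H /\
    ~ krull H) /\
   (* 3 *)
   transfer_hom (@propto_fst H0 D : H -> H0) /\
   (* 4 *)
   (atomic H0 -> atomic D ->
      (forall (u : H0) (d : D) (hu : atom u),
         let ud : H := propto_pair d (atom_nonunit hu) in
         let eps := if `[< mprime u /\ d \in munit >] then Fin 1 else Fin 0 in
         enat_le (enat_max (omega u) (omega d)) (omega ud) /\
         enat_le (omega ud) (enat_add (enat_add (omega u) (omega d)) eps) /\
         (omega ud <> Infty <-> omega u <> Infty /\ omega d <> Infty)) /\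
      (~ is_group D -> omegaS H = Infty /\ tameS H = Infty)) /\
   (* 5 *)
   (atomic H0 -> is_group D ->
      (forall (u : H0) (d : D) (hu : atom u),
         let ud : H := propto_pair d (atom_nonunit hu) in
         (mprime u ->
            [/\ omega ud = Fin 2, tau ud = Fin 1 & tame (cls ud) = Fin 2]) /\
         (~ mprime u ->
            [/\ omega ud = omega u, tau ud = tau u
              & tame (cls ud) = tame (cls u)])) /\
      tameS H = enat_max (Fin 2) (tameS H0) /\
      omegaS H = enat_max (Fin 2) (omegaS H0) /\
      tauS H = enat_max (Fin 1) (tauS H0)) /\
   (* 6 *)
   (atomic H0 -> atomic D ->
      (forall (d : D) (a : H0) (ha : a \notin munit), ~ atom a ->
         let ad : H := propto_pair d ha in
         let case_i :=
           (forall e : D, e \in munit <-> e = 1 \/ e = d) /\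
           (exists2 u : H0, atom u & Zof a = [set msetn 2 (cls u)]%classic) in
         let case_ii := [/\ reduced D, d = 1 & cat_deg a = Fin 0] in
         let case_iii :=
           [/\ reduced D, atom d
             & exists (u : H0) (k : nat),
                 [/\ atom u, (2 <= k)%N
                   & Zof a = [set msetn k (cls u)]%classic]] in
         (case_i \/ case_ii \/ case_iii -> cat_deg ad = Fin 0) /\
         (~ (case_i \/ case_ii \/ case_iii) ->
            cat_deg ad = enat_max (Fin 2) (cat_deg a))) /\
      cat_degS H = enat_max (Fin 2) (cat_degS H0))).

Proof.
split; first exact: propto_closed.
split.
  move=> trivial [a d]; split=> [|/= ->]; last first.
    by rewrite inE /= eqxx andbT orNb.
  by case: trivial => [D1 _|gH0]; [apply: D1 | rewrite inE /= gH0 /= => /eqP].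
move=> nD nG H; have h := propto_proj_propto H0 D.
have [d d1] : exists d : D, d <> 1 by apply/existsNP.
have [c nc] : exists c : H0, c \notin munit.
  by have /existsNP[c /negP nc] := nG; exists c.
split; [|split; [|split; [|split; [|split]]]].
- move=> x; split=> [|[ux _]]; rewrite -?(munit_p h) // => ux.
  by split=> //; apply: (proj_unit h).
- split; last split.
  + exists (quot_proj (@propto_fst H0 D : H -> H0) (@propto_snd H0 D)); split.
    * exact: (quot_proj_morph h).
    * exact: (quot_proj_bij h nc).
    * exact: (quot_proj_qincl h).
    * exact: (quot_proj_cic h nc).
  + exact: propto_not_saturated nc d1.
  + by split; [apply: (not_cic h nc d1) | apply: (not_krull h nc d1)].
- split.
  + exact: (proj_fst_morph h).
  (* [H] contains [(b, 1)] for every [b], so the unit factor in (T1) can be taken to be 1. *)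
  + move=> b; exists (propto_mk b 1), 1; rewrite munit1 mulg1; split=> //.
    by rewrite (proj_rp1 h).
  + exact: (munit_p h).
  + move=> u a b /(proj_split h)[v [w [-> <- <-]]]; exists v, w.
    by split=> //; apply: associated_refl.
- move=> Sat Dat; have [u1 u1A] := atomic_exists_atom Sat nG.
  split=> [u e hu ud eps|nDG]; last first.
    by rewrite (omegaS_Infty h Dat nDG u1A) (tameS_Infty h Dat nDG u1A).
  have udA : atom ud by apply/(atom_p h).
  split; [|split].
  + by rewrite enat_max_le (omega_p_le h udA.1) (omega_q_le h udA).
  + exact: (omega_le_sum h Sat Dat udA).
  + exact: (omega_finite h Sat Dat udA).
- move=> Sat Dgrp; have [u0 u0A] := atomic_exists_atom Sat nG; split.
    move=> u e hu ud; have udA : atom ud by apply/(atom_p h).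
    split=> up; first exact: (prime_case h Dgrp nD udA up).
    exact: (nonprime_case h Sat Dgrp udA up).
  by have [-> -> ->] := sup_group_case h Dgrp nD u0A.
move=> Sat Dat; have [u0 u0A] := atomic_exists_atom Sat nG; split.
  move=> e a ha naA ad case_i case_ii case_iii; split; first exact: (cat_deg_cases h (x := ad)).
  exact: (cat_deg_other h (x := ad)).
exact: (cat_degS_proj h u0A nD).
Qed.
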